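(* Let $p$ be an odd prime, $q=p^k$, $r=p^s$ with $s\mid k$, let $n$ be even with $s\le n/2$, let $V_n$ be an $n$-dimensional $\mathbb{F}_p$-vector space with a nondegenerate symmetric bilinear form, and let $K_0$ be an $\mathbb{F}_r$-subspace of $\mathbb{F}_q$, $K_1=\mathbb{F}_q\setminus K_0$. Let $(P^{(z)})_{z\in\mathbb{F}_q}$ be a family of functions $V_n\to\mathbb{F}_r$ such that: (1) $P^{(cz)}=P^{(z)}$ for all $z\in\mathbb{F}_q$ and $c\in\mathbb{F}_r^*$; (2) every $P^{(z)}$, $z\in\mathbb{F}_q$ (including $z=0$), is vectorial bent with weakly regular components, with sign pattern $(\varepsilon_{z,t})_{t\in\mathbb{F}_r^*}$, and is of inversion type, with $G^{(z)}\colon V_n\to\mathbb{F}_r$ such that $(P^{(z)}_t)^*=\mathrm{Tr}^s_1(t^{-1}G^{(z)})$ for all $t\in\mathbb{F}_r^*$; (3) the sign pattern $(\varepsilon_{z,t})_t$ is the same for all $z\in K_1$, and it is the same for all $z\in K_0\setminus\{0\}$; (4) $P^{(0)}(0)=0$ and $G^{(0)}(0)=0$, i.e. $W_{P^{(0)}_t}(0)=\varepsilon_{0,t}\,p^{n/2}$ for all $t\in\mathbb{F}_r^*$. Let $H\colon V=V_n\times\mathbb{F}_q\times\mathbb{F}_q\to\mathbb{F}_r$, $H(x,y,z)=P^{(z)}(x)+\mathrm{Tr}^k_s(yz)$, and let $\Omega=\Omega(H,K_0)$, with cells $c_i,d_i,e_i$ ($i\in\mathbb{F}_r$), $B_1,B_2,\{0\}$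 as in the context. For $s'\mid s$, $r'=p^{s'}$ and $\gamma\in\mathbb{F}_r^*$ let $H'=\mathrm{Tr}^s_{s'}(\gamma H)\colon V\to\mathbb{F}_{r'}$ and let $\Omega'=\Omega'_\gamma=\Omega(H',K_0)$ be the analogous partition at level $s'$, with cells $c'_j,d'_j,e'_j$ ($j\in\mathbb{F}_{r'}$), $B_1,B_2,\{0\}$ as in the context. Then for every $s'\mid s$ and every $\gamma\in\mathbb{F}_r^*$: (i) $\Omega'$ is a fusion of $\Omega$: $c'_j=\bigcup_{i:\,\mathrm{Tr}^s_{s'}(\gamma i)=j}c_i$, and likewise $d'_j=\bigcup_{i:\,\mathrm{Tr}^s_{s'}(\gamma i)=j}d_i$ and $e'_j=\bigcup_{i:\,\mathrm{Tr}^s_{s'}(\gamma i)=j}e_i$. (ii) $\Omega'$ is Fourier-reflexive and induces an association scheme which is a fusion scheme of the scheme induced by $\Omega$, with $2r'+\delta'$ classes if $K_0\in\{\{0\},\mathbb{F}_q\}$ and $3r'+1+\delta'$ classes otherwise, where $\delta'=\delta$ if $s'=s$ and $\delta'=1$ if $s'<s$; here $\delta=0$ if $n=2s$ and $\varepsilon_{0,t}=-1$ for all $t\in\mathbb{F}_r^*$, and $\delta=1$ otherwise. (iii) If $\gamma_1,\gamma_2\in\mathbb{F}_r^*$ lie in different cosets of $\mathbb{F}_{r'}^*$, then $\Omega'_{\gamma_1}\ne\Omega'_{\gamma_2}$. Hence the scheme induced by $\Omega$ has, for every $s'\mid s$, at least $(r-1)/(r'-1)$ different fusion schemes of this kind.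
   Context: Notation: $\mathrm{Tr}^a_b$ is the trace $\mathbb{F}_{p^a}\to\mathbb{F}_{p^b}$ ($b\mid a$); $\zeta_p=e^{2\pi i/p}$. For an even-dimensional $\mathbb{F}_p$-space $V_n$ of dimension $n$ with nondegenerate symmetric bilinear form $\langle\cdot,\cdot\rangle$ and $f\colon V_n\to\mathbb{F}_p$, the Walsh transform is $W_f(b)=\sum_{x\in V_n}\zeta_p^{f(x)-\langle b,x\rangle}$. $f$ is bent if $|W_f(b)|=p^{n/2}$ for all $b$; then (as $n$ is even) $W_f(b)=\varepsilon_f(b)p^{n/2}\zeta_p^{f^*(b)}$ with $\varepsilon_f(b)\in\{\pm1\}$ and a function $f^*\colon V_n\to\mathbb{F}_p$, the dual of $f$. A bent $f$ is weakly regular if $\varepsilon_f$ is constant (this constant is its sign). For $P\colon V_n\to\mathbb{F}_r$ and $t\in\mathbb{F}_r^*$ the component is $P_t=\mathrm{Tr}^s_1(tP)$. $P$ is vectorial bent if all $P_t$, $t\ne0$, are bent; it has weakly regular components if every $P_t$ is weakly regular, with sign $\varepsilon_{P,t}$; $(\varepsilon_{P,t})_{t\in\mathbb{F}_r^*}$ is its sign pattern. A vectorial bent $P$ is of inversion type if there is $G\colon V_n\to\mathbb{F}_r$ with $(P_t)^*=\mathrm{Tr}^s_1(t^{-1}G)$ for all $t\in\mathbb{F}_r^*$. $V=V_n\times\mathbb{F}_q\times\mathbb{F}_q$ carries the form $\langle(u,v,w),(x,y,z)\rangle=\langle u,x\rangle+\mathrm{Tr}^k_1(vy)+\mathrm{Tr}^k_1(wz)$.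 Partitions: let $K_0^\perp=\{y\in\mathbb{F}_q:\mathrm{Tr}^k_1(zy)=0\ \forall z\in K_0\}$, $B_1=\{(0,y,0): y\in K_0^\perp\setminus\{0\}\}$, $B_2=\{(0,y,0): y\in\mathbb{F}_q\setminus K_0^\perp\}$. For $i\in\mathbb{F}_r$ put $c_i=\{(x,y,z): z\in K_1, H(x,y,z)=i\}$, $d_i=\{(x,y,z): z\in K_0\setminus\{0\}, H(x,y,z)=i\}$, $e_i=\{(x,y,0): x\neq0, P^{(0)}(x)=i\}$, and $\Omega(H,K_0)=\{\{0\},B_1,B_2,e_i,d_i,c_i\ (i\in\mathbb{F}_r)\}$ with empty cells omitted. For $j\in\mathbb{F}_{r'}$ put $c'_j=\{(x,y,z): z\in K_1, H'(x,y,z)=j\}$, $d'_j=\{(x,y,z): z\in K_0\setminus\{0\}, H'(x,y,z)=j\}$, $e'_j=\{(x,y,0): x\neq0, \mathrm{Tr}^s_{s'}(\gamma P^{(0)}(x))=j\}$, and $\Omega(H',K_0)=\{\{0\},B_1,B_2,e'_j,d'_j,c'_j\ (j\in\mathbb{F}_{r'})\}$ with empty cells omitted. Fourier-reflexivity: for $\xi\in V$ and $S\subseteq V$ let $\chi_\xi(S)=\sum_{s\in S}\zeta_p^{-\langle\xi,s\rangle}$. The dual partition $\widehat\Omega$ of a partition $\Omega=\{\{0\},U_1,\dots,U_d\}$ of $V$ (with $U_0=\{0\}$) is the partition of $V$ into the level sets of $\xi\mapsto(\chi_\xi(U_0),\dots,\chi_\xi(U_d))$; $\Omega$ is Fourier-reflexive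 if $|\widehat\Omega|=|\Omega|$. $\Omega$ induces an association scheme if the relations $R_0=\{(x,x)\}$, $R_i=\{(x,y): y-x\in U_i\}$ form a ($d$-class, translation) association scheme on $V$. A fusion scheme of a scheme is an association scheme each of whose relations is a union of relations of the given one. *)

(* Defs.v *)
From HB Require Import structures.
From mathcomp Require Import all_boot all_order all_algebra all_field.
From mathcomp Require Import reals trigo.
From mathcomp Require Import complex.

Set Implicit Arguments.
Unset Strict Implicit.
Unset Printing Implicit Defensive.

Import GRing.Theory.

Local Open Scope ring_scope.

(* Makes products of finZmodTypes canonically finZmodTypes. *)
HB.saturate prod.

(* All finite fields live inside one field Fq with #|Fq| = p ^ k: for m
   dividing k, the subfield with p ^ m elements consists of the roots of
   X ^ (p ^ m) - X. *)
Section Subfields.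
Variables (p : nat) (Fq : finFieldType).

Definition GF (m : nat) : {set Fq} := [set x | x ^+ (p ^ m) == x].

Definition GFstar (m : nat) : {set Fq} := GF m :\ 0.

(* The trace from GF a to GF b, for b dividing a: the sum of the conjugates of
   x under the Galois group, which is generated by x |-> x ^+ (p ^ b). *)
Definition Tr (a b : nat) (x : Fq) : Fq := \sum_(i < a %/ b) x ^+ ((p ^ b) ^ i).

(* The identification of the prime field GF 1 with 'F_p; the default value is
   only used outside GF 1. *)
Definition toFp (c : Fq) : 'F_p := odflt 0 [pick a : 'F_p | (a : nat)%:R == c].

Definition TrFp (a : nat) (x : Fq) : 'F_p := toFp (Tr a 1 x).

Definition GFsubspace (m : nat) (K : {set Fq}) : Prop :=
  [/\ 0 \in K,
      {in K &, forall x y, x + y \in K} &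
      {in GF m & K, forall c x, c * x \in K}].

End Subfields.

Section Characters.
Variables (R : realType) (p : nat).

Definition zeta : R[i] :=
  (cos (2 * pi / p%:R) +i* sin (2 * pi / p%:R))%C.

Definition zexp (a : 'F_p) : R[i] := zeta ^+ (a : nat).

Definition chi (V : finType) (form : V -> V -> 'F_p) (xi : V) (S : {set V})
  : R[i] := \sum_(x in S) zexp (- form xi x).

End Characters.

Section Bent.
Variables (R : realType) (p : nat) (Vn : vectType 'F_p).
Variable form : finvect_type Vn -> finvect_type Vn -> 'F_p.
Implicit Types f g : finvect_type Vn -> 'F_p.

Definition Walsh f (b : finvect_type Vn) : R[i] :=
  \sum_(x : finvect_type Vn) zexp R (f x - form b x).

(* p ^ (n / 2); only used for an even dimension n. *)
Definition bent_norm : R[i] := (p ^ (\dim {:Vn})./2)%:R.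

Definition bent f : Prop := forall b, `|Walsh f b| = bent_norm.

(* For p odd, eps and fs are uniquely determined by f. *)
Definition Walsh_decomposition f (eps : finvect_type Vn -> int)
    (fs : finvect_type Vn -> 'F_p) : Prop :=
  forall b, (eps b = 1 \/ eps b = -1)
    /\ Walsh f b = (eps b)%:~R * bent_norm * zexp R (fs b).

Definition is_dual f fs : Prop :=
  exists eps : finvect_type Vn -> int, Walsh_decomposition f eps fs.

Definition weakly_regular_with_sign f (e : int) : Prop :=
  bent f /\
  exists fs : finvect_type Vn -> 'F_p, Walsh_decomposition f (fun=> e) fs.

Variables (Fq : finFieldType) (s : nat).
Implicit Types P G : finvect_type Vn -> Fq.

Definition component P (t : Fq) : finvect_type Vn -> 'F_p :=
  fun x => TrFp p s (t * P x).

Definition vectorial_bent P : Prop :=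
  {in GFstar p Fq s, forall t, bent (component P t)}.

Definition sign_pattern P (eps : Fq -> int) : Prop :=
  {in GFstar p Fq s, forall t, weakly_regular_with_sign (component P t) (eps t)}.

Definition inversion_type P G : Prop :=
  {in GFstar p Fq s, forall t,
    is_dual (component P t) (fun x => TrFp p s (t^-1 * G x))}.

End Bent.

(* A is a fusion of B: every member of A is a union of members of B. *)
Definition fusion (T : finType) (A B : {set {set T}}) : Prop :=
  {in A, forall S, exists2 C : {set {set T}}, C \subset B & S = cover C}.

Section FourierReflexive.
Variables (R : realType) (p : nat) (V : finZmodType) (form : V -> V -> 'F_p).
Implicit Type Omega : {set {set V}}.

Definition dual_partition Omega : {set {set V}} :=
  equivalence_partition
    (fun xi eta => [forall U in Omega, chi R form xi U == chi R form eta U])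
    [set: V].

Definition Fourier_reflexive Omega : Prop :=
  [/\ partition Omega [set: V], [set 0] \in Omega &
      #|dual_partition Omega| = #|Omega|].

End FourierReflexive.

Section Schemes.

(* A d-class (not necessarily symmetric, but commutative) association scheme,
   given by the set of its d + 1 relations. *)
Definition association_scheme (X : finType) (d : nat) (S : {set {set X * X}})
  : Prop :=
  [/\ partition S [set: X * X] /\ #|S| = d.+1,
      [set u | u.1 == u.2] \in S,
      {in S, forall A : {set X * X}, [set u | (u.2, u.1) \in A] \in S} &
      {in S & S & S, forall A B C : {set X * X}, exists N : nat,
        forall x y, (x, y) \in C ->
          #|[set z | ((x, z) \in A) && ((z, y) \in B)]| = N /\
          #|[set z | ((x, z) \in B) && ((z, y) \in A)]| = N}].

Definition fusion_scheme (X : finType) (S' S : {set {set X * X}}) : Prop :=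
  [/\ exists d, association_scheme d S', exists d, association_scheme d S &
      fusion S' S].

Definition relations (V : finZmodType) (Omega : {set {set V}})
  : {set {set V * V}} :=
  [set [set u : V * V | u.2 - u.1 \in U] | U : {set V} in Omega].

End Schemes.

Section Omega.
Variables (p k : nat) (Vn : vectType 'F_p) (Fq : finFieldType).
Local Notation vn := (finvect_type Vn).
Local Notation V := (vn * Fq * Fq)%type.

Definition formV (form : vn -> vn -> 'F_p) (a b : V) : 'F_p :=
  form a.1.1 b.1.1 + TrFp p k (a.1.2 * b.1.2) + TrFp p k (a.2 * b.2).

Variable K0 : {set Fq}.

Definition perp : {set Fq} := [set y | [forall z in K0, Tr p k 1 (z * y) == 0]].

Definition cellB1 : {set V} :=
  [set v | [&& v.1.1 == 0, v.1.2 \in perp :\ 0 & v.2 == 0]].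
Definition cellB2 : {set V} :=
  [set v | [&& v.1.1 == 0, v.1.2 \notin perp & v.2 == 0]].
Definition cellc (H : V -> Fq) (i : Fq) : {set V} :=
  [set v | (v.2 \notin K0) && (H v == i)].
Definition celld (H : V -> Fq) (i : Fq) : {set V} :=
  [set v | (v.2 \in K0 :\ 0) && (H v == i)].
Definition celle (P0 : vn -> Fq) (i : Fq) : {set V} :=
  [set v | [&& v.2 == 0, v.1.1 != 0 & P0 v.1.1 == i]].

(* The partition for H with values in GF m; P0 is the restriction of H to
   third coordinate 0, where H does not depend on the second one. *)
Definition Omega (m : nat) (H : V -> Fq) (P0 : vn -> Fq) : {set {set V}} :=
  ([set [set (0 : V)]; cellB1; cellB2]
    :|: [set celle P0 i | i in GF p Fq m]
    :|: [set celld H i | i in GF p Fq m]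
    :|: [set cellc H i | i in GF p Fq m]) :\ set0.

Definition Hfun (s : nat) (P : Fq -> vn -> Fq) (v : V) : Fq :=
  P v.2 v.1.1 + Tr p k s (v.1.2 * v.2).

Definition Hfun' (s s' : nat) (gamma : Fq) (P : Fq -> vn -> Fq) (v : V) : Fq :=
  Tr p s s' (gamma * Hfun s P v).

Definition P0' (s s' : nat) (gamma : Fq) (P : Fq -> vn -> Fq) (x : vn) : Fq :=
  Tr p s s' (gamma * P 0 x).

Definition OmegaH (s : nat) (P : Fq -> vn -> Fq) : {set {set V}} :=
  Omega s (Hfun s P) (P 0).

Definition OmegaH' (s s' : nat) (gamma : Fq) (P : Fq -> vn -> Fq)
  : {set {set V}} :=
  Omega s' (Hfun' s s' gamma P) (P0' s s' gamma P).

End Omega.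

(* Main.v *)
(* Give v = (x, y, z) the label consisting of the part (c, d, e, B_2, B_1 or {0})
   containing it and of the value H'(v), so that the partition is formed by the
   level sets of the label. Let xi = (a, b, c) and let S be one of K_1, K_0 \ {0}
   and {0}. For t <> 0, summing over y forces z = b / t, and P^(b/t) = P^(b); the
   sum of zeta^(Tr(t H(v)) - <xi, v>) over the v with z in S is then a Walsh
   coefficient of P^(b)_t, which by inversion type is a sign times a power of p
   times zeta^Tr(t^-1 (G^(b)(a) - Tr(b c))). So the Fourier transforms of the
   cells only depend on the label of (a, -c, b) for the family G^(z) and the
   multiplier 1 / gamma. Both labels take the same number of values: for z <> 0 all
   values of H' occur, and the two fibre counts on z = 0 are given by the same
   sum of signs. As the Fourier transform is injective, the dual partition has at
   least as many cells as the given one, hence equality holds. Then every function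
   constant on the dual cells is the transform of a function constant on the
   cells; products and conjugates of such functions give the association scheme.
   Finally, the cells determine the kernel of h |-> Tr(gamma h), hence gamma up to
   the subfield. *)
Require Import Defs.
From mathcomp Require Import all_boot all_order all_algebra all_field.
From mathcomp Require Import reals trigo.
From mathcomp Require Import complex.
From mathcomp Require Import zify ring.

Set Implicit Arguments.
Unset Strict Implicit.
Unset Printing Implicit Defensive.

Import GRing.Theory.

Local Open Scope ring_scope.

(** * Subfields and traces *)

Section SubfieldTrace.
Variables (p k : nat) (Fq : finFieldType).
Hypotheses (p_pr : prime p) (cardF : #|Fq| = (p ^ k)%N).
Implicit Types x y c : Fq.

Lemma k_gt0 : (0 < k)%N.
Proof.
case: k cardF => // cF; have := card_finNzRing_gt1 Fq.
by rewrite cF.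
Qed.

(** Since the cardinality is a power of p, the characteristic is p, and this is the additivity of an
    iterated Frobenius map. *)
Lemma exprDp m x y : (x + y) ^+ (p ^ m) = x ^+ (p ^ m) + y ^+ (p ^ m).
Proof.
apply: exprDn_pchar; rewrite (eq_pnat _ (pcharf_eq (card_finPcharP cardF p_pr))).
by rewrite pnatX pnat_id.
Qed.

Lemma expr0p m : 0 ^+ (p ^ m) = 0 :> Fq.
Proof. by rewrite expr0n gtn_eqF // expn_gt0 prime_gt0. Qed.

Lemma exprp_sum m (I : Type) (r : seq I) (F : I -> Fq) :
  (\sum_(i <- r) F i) ^+ (p ^ m) = \sum_(i <- r) F i ^+ (p ^ m).
Proof. exact: (big_morph (fun y => y ^+ _) (exprDp m) (expr0p m)). Qed.

Lemma GFP m x : reflect (x ^+ (p ^ m) = x) (x \in GF p Fq m).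
Proof. by rewrite inE; exact: eqP. Qed.

Lemma GF_k x : x \in GF p Fq k.
Proof. by apply/GFP; rewrite -cardF expf_card. Qed.

Lemma GF0 m : 0 \in GF p Fq m.
Proof. by apply/GFP; exact: expr0p. Qed.

Lemma GF1 m : 1 \in GF p Fq m.
Proof. by apply/GFP; rewrite expr1n. Qed.

Lemma GFD m : {in GF p Fq m &, forall x y, x + y \in GF p Fq m}.
Proof. by move=> x y /GFP xm /GFP ym; apply/GFP; rewrite exprDp xm ym. Qed.

Lemma GFM m : {in GF p Fq m &, forall x y, x * y \in GF p Fq m}.
Proof. by move=> x y /GFP xm /GFP ym; apply/GFP; rewrite exprMn xm ym. Qed.

Lemma GFV m : {in GF p Fq m, forall x, x^-1 \in GF p Fq m}.
Proof. by move=> x /GFP xm; apply/GFP; rewrite exprVn xm. Qed.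

Lemma GFN m : {in GF p Fq m, forall x, - x \in GF p Fq m}.
Proof.
move=> x xm; suff: - 1 \in GF p Fq m by move=> m1; rewrite -mulN1r GFM.
apply/GFP/eqP; rewrite -subr_eq0 opprK -[X in _ + X](expr1n _ (p ^ m)) -exprDp addNr.
by rewrite expr0p.
Qed.

Lemma GFB m : {in GF p Fq m &, forall x y, x - y \in GF p Fq m}.
Proof. by move=> x y xm ym; rewrite GFD ?GFN. Qed.

Lemma expr_GF m i : {in GF p Fq m, forall x, x ^+ ((p ^ m) ^ i) = x}.
Proof.
move=> x /GFP xm; elim: i => [|i IHi]; first by rewrite expn0 expr1.
by rewrite expnS exprM xm.
Qed.

Lemma GF_dvd m l : (m %| l)%N -> {subset GF p Fq m <= GF p Fq l}.
Proof.
by case/dvdnP=> d -> x /(expr_GF d) xm; apply/GFP; rewrite mulnC expnM.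
Qed.

Lemma GFstarP m x : reflect (x \in GF p Fq m /\ x != 0) (x \in GFstar p Fq m).
Proof. by rewrite in_setD1 andbC; exact: andP. Qed.

Lemma GFstarV m x : x \in GFstar p Fq m -> x^-1 \in GFstar p Fq m.
Proof. by case/GFstarP=> xm x0; apply/GFstarP; rewrite GFV ?invr_eq0. Qed.

Lemma GFstarM m : {in GFstar p Fq m &, forall x y, x * y \in GFstar p Fq m}.
Proof.
move=> x y /GFstarP[xm x0] /GFstarP[ym y0].
by apply/GFstarP; rewrite GFM // mulf_neq0.
Qed.

Lemma GFstar_dvd m l : (m %| l)%N -> {subset GFstar p Fq m <= GFstar p Fq l}.
Proof. by move=> /GF_dvd ml x /GFstarP[/ml xl x0]; apply/GFstarP. Qed.

Lemma TrD a b : {morph Tr p a b : x y / x + y : Fq}.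
Proof.
move=> x y; rewrite /Tr -big_split; apply: eq_bigr => i _.
by rewrite -expnM exprDp.
Qed.

Lemma TrZ a b c x : c \in GF p Fq b -> Tr p a b (c * x) = c * Tr p a b x.
Proof.
by move=> cb; rewrite /Tr mulr_sumr; apply: eq_bigr => i _; rewrite exprMn (expr_GF _ cb).
Qed.

Lemma Tr0 a b : Tr p a b 0 = 0 :> Fq.
Proof. by rewrite -[X in Tr _ _ _ X](mul0r 0) TrZ ?GF0 // mul0r. Qed.

Lemma TrN a b : {morph Tr p a b : x / - x : Fq}.
Proof. by move=> x; apply/eqP; rewrite -addr_eq0 -TrD addNr Tr0. Qed.

Lemma TrB a b : {morph Tr p a b : x y / x - y : Fq}.
Proof. by move=> x y; rewrite TrD TrN. Qed.

Lemma Tr_id a x : (0 < a)%N -> Tr p a a x = x.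
Proof. by move=> a0; rewrite /Tr divnn a0 big_ord1. Qed.

(** Raising to the power [p ^ b] shifts the conjugates by one place; the last one wraps around to
    [x] because [x ^+ (p ^ a) = x]. *)
Lemma Tr_GF a b x : (b %| a)%N -> x \in GF p Fq a -> Tr p a b x \in GF p Fq b.
Proof.
move=> ba /GFP xa; apply/GFP; rewrite /Tr exprp_sum.
under eq_bigr => i _ do rewrite -exprM -expnSr.
case E: (a %/ b)%N => [|d]; first by rewrite !big_ord0.
rewrite big_ord_recr [RHS]big_ord_recl /= -E -expnM mulnC divnK // xa.
by rewrite expn0 expr1 addrC.
Qed.

(** With [a = m * l * c] and [b = l * c], every index below [m * l] is uniquely [i * l + j] with
    [i < m] and [j < l], so the double sum runs over all conjugates once. *)
Lemma Tr_trans a b (c : nat) x : (b %| a)%N -> (c %| b)%N -> (0 < b)%N ->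
  Tr p b c (Tr p a b x) = Tr p a c x.
Proof.
case/dvdnP=> m -> {a} /dvdnP[l -> {b}]; rewrite muln_gt0 => /andP[l0 c0].
rewrite /Tr (mulnK m) ?muln_gt0 ?l0 // (mulnK l) // mulnA (mulnK (m * l)) //.
under eq_bigr => j _ do rewrite -expnM exprp_sum.
rewrite exchange_big /= -(big_mkord xpredT (fun i => x ^+ ((p ^ c) ^ i))).
rewrite big_nat_mul big_mkord; apply: eq_bigr => i _.
rewrite -{1}[(i * l)%N]add0n big_addn mulSn addnK big_mkord.
apply: eq_bigr => j _; rewrite -exprM -!expnM -expnD; congr (_ ^+ (_ ^ _)).
by rewrite mulnDr addnC (mulnC i) mulnA [(c * l)%N]mulnC.
Qed.

(** The fibre consists of roots of a nonzero polynomial whose top exponent is p^(k - m). *)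
Lemma card_Tr_fibre m j : (m %| k)%N -> (0 < m)%N ->
  (#|[set x : Fq | Tr p k m x == j]| <= p ^ (k - m))%N.
Proof.
move=> mk m0; set q := \sum_(i < k %/ m) 'X^((p ^ m) ^ i) - j%:P : {poly Fq}.
have d0 : (0 < k %/ m)%N by rewrite divn_gt0 // dvdn_leq ?k_gt0.
have p1 := prime_gt1 p_pr.
have q0 : q != 0.
  (* The coefficient of X is 1: only the summand [i = 0] contributes to it. *)
  apply/eqP => /(congr1 (fun r : {poly Fq} => r`_1)); rewrite coef0 /q coefB coefC.
  rewrite coef_sum subr0 -(prednK d0) big_ord_recl expn0 coefXn eqxx /=.
  rewrite big1 ?addr0 => [/eqP|i _]; first by rewrite oner_eq0.
  rewrite coefXn /bump /= add1n -expnM eq_sym -[X in (_ == X)%N](expn0 p).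
  by rewrite eqn_exp2l // muln_eq0 gtn_eqF.
have sq : (size q <= (p ^ (k - m)).+1)%N.
  apply: leq_trans (size_polyD _ _) _; rewrite size_polyN geq_max.
  rewrite (leq_trans (size_polyC_leq1 _)) // andbT.
  apply: leq_trans (size_sum _ _ _) _; apply/bigmax_leqP => i _.
  have mi : (m * i <= k - m)%N.
    rewrite leq_subRL; last by rewrite dvdn_leq // k_gt0.
    by rewrite -mulnS mulnC -leq_divRL.
  by rewrite size_polyXn ltnS -expnM leq_exp2l.
rewrite -ltnS (leq_trans _ sq) // cardE max_poly_roots ?enum_uniq //.
apply/allP => x; rewrite mem_enum inE => /eqP xj.
rewrite rootE /q hornerD hornerN hornerC horner_sum.
by under eq_bigr => i _ do rewrite hornerXn; rewrite -/(Tr p k m x) xj subrr.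
Qed.

Lemma card_GF_le m : (0 < m)%N -> (#|GF p Fq m| <= p ^ m)%N.
Proof.
move=> m0; set q := 'X^(p ^ m) - 'X : {poly Fq}.
have p1 : (1 < p ^ m)%N by rewrite -(exp1n m) ltn_exp2r // prime_gt1.
have sq : size q = (p ^ m).+1.
  by rewrite size_polyDl ?size_polyXn // size_polyN size_polyX ltnS.
rewrite -ltnS -sq cardE max_poly_roots ?enum_uniq //; first by rewrite -size_poly_eq0 sq.
apply/allP => x; rewrite mem_enum => /GFP xm.
by rewrite rootE hornerD hornerN hornerXn hornerX xm subrr.
Qed.

(** Two upper bounds squeeze the trace. The p^k elements lie in fibres of size at most p^(k - m), so
    the image has at least p^m elements; it sits inside [GF m], which has at most p^m. Both the
    cardinality and surjectivity follow. *)
Lemma card_GF_Tr m : (m %| k)%N -> (0 < m)%N ->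
  #|GF p Fq m| = (p ^ m)%N /\ {in GF p Fq m, forall j, exists x, Tr p k m x = j}.
Proof.
move=> mk m0; have mlek : (m <= k)%N by rewrite dvdn_leq ?k_gt0.
pose im := [set Tr p k m x | x in [set: Fq]].
have im_sub : im \subset GF p Fq m.
  by apply/subsetP => _ /imsetP[x _ ->]; rewrite Tr_GF ?GF_k.
have im_ge : (p ^ m <= #|im|)%N.
  have pkm : (0 < p ^ (k - m))%N by rewrite expn_gt0 prime_gt0.
  rewrite -(leq_pmul2r pkm) -expnD subnKC // -cardF -cardsT -sum1_card.
  rewrite (partition_big_imset (Tr p k m)) /= -sum_nat_const; apply: leq_sum => j _.
  apply: leq_trans (card_Tr_fibre j mk m0); rewrite -sum1_card.
  by apply: eq_leq; apply: eq_bigl => x; rewrite !inE.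
have imE : im = GF p Fq m.
  by apply/eqP; rewrite eqEcard im_sub (leq_trans (card_GF_le m0)).
split; first by apply/eqP; rewrite eqn_leq card_GF_le // -imE.
by rewrite -imE => j /imsetP[x _ ->]; exists x.
Qed.

Lemma card_GF m : (m %| k)%N -> (0 < m)%N -> #|GF p Fq m| = (p ^ m)%N.
Proof. by move=> mk m0; have [] := card_GF_Tr mk m0. Qed.

Lemma Tr_surj l m j : (l %| k)%N -> (m %| l)%N -> (0 < l)%N ->
  j \in GF p Fq m -> exists2 x, x \in GF p Fq l & Tr p l m x = j.
Proof.
move=> lk ml l0 jm; have mk := dvdn_trans ml lk.
have [_ /(_ j jm)[x <-]] := card_GF_Tr mk (dvdn_gt0 l0 ml).
by exists (Tr p k l x); rewrite ?Tr_trans ?Tr_GF ?GF_k.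
Qed.

Lemma Fp_nat_GF1 (a : nat) : a%:R \in GF p Fq 1.
Proof.
elim: a => [|a IHa]; first exact: GF0.
by rewrite -natr1 GFD ?GF1.
Qed.

Let pF : p \in [pchar Fq] := card_finPcharP cardF p_pr.

Lemma natr_modp (a : nat) : (a %% p)%:R = a%:R :> Fq.
Proof.
by rewrite [in RHS](divn_eq a p) natrD natrM (pcharf0 pF) mulr0 add0r.
Qed.

Lemma natr_eq_modp (a b : nat) : (a%:R == b%:R :> Fq) = (a == b %[mod p]).
Proof.
wlog ab : a b / (a <= b)%N.
  by move=> IH; case/orP: (leq_total a b) => /IH //; rewrite eq_sym => ->; rewrite eq_sym.
by rewrite eq_sym -subr_eq0 -natrB // -(dvdn_pcharf pF) -eqn_mod_dvd // eq_sym.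
Qed.

Lemma val_Fp_lt (a : 'F_p) : (a < p)%N.
Proof. by rewrite -[X in (_ < X)%N](Fp_cast p_pr) ltn_ord. Qed.

Lemma natr_Fp_inj : injective (fun a : 'F_p => (a : nat)%:R : Fq).
Proof.
move=> a b /eqP; rewrite natr_eq_modp !modn_small ?val_Fp_lt // => /eqP ab.
exact: val_inj.
Qed.

Lemma toFp_nat (a : nat) : toFp p (a%:R : Fq) = a%:R.
Proof.
rewrite /toFp; case: pickP => [b|/(_ a%:R)].
  rewrite natr_eq_modp => /eqP ba; apply: val_inj; rewrite /= val_Fp_nat // -ba.
  by rewrite modn_small ?val_Fp_lt.
by rewrite val_Fp_nat // natr_modp eqxx.
Qed.

(** The canonical map from 'F_p into [GF 1] is injective between sets of p elements, hence onto, so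
    the default value of [toFp] is never met here. *)
Lemma toFpK c : c \in GF p Fq 1 -> (toFp p c : nat)%:R = c.
Proof.
have <- : (fun a : 'F_p => (a : nat)%:R : Fq) @: [set: 'F_p] = GF p Fq 1.
  apply/eqP; rewrite eqEcard; apply/andP; split.
    by apply/subsetP => _ /imsetP[a _ ->]; exact: Fp_nat_GF1.
  rewrite card_imset; last exact: natr_Fp_inj.
  by rewrite cardsT card_Fp // card_GF ?dvd1n ?expn1.
by case/imsetP => a _ ->; rewrite toFp_nat val_Fp_nat // natr_modp.
Qed.

Lemma toFpD : {in GF p Fq 1 &, {morph (@toFp p Fq) : x y / x + y}}.
Proof.
move=> x y x1 y1; rewrite -[X in toFp p (X + _)]toFpK // -[X in toFp p (_ + X)]toFpK //.
by rewrite -natrD toFp_nat natrD !natr_Zp.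
Qed.

Lemma toFp_eq0 x : x \in GF p Fq 1 -> (toFp p x == 0) = (x == 0).
Proof.
move=> x1; apply/eqP/eqP => [x0|->]; first by rewrite -(toFpK x1) x0.
by rewrite -[0 in LHS](mulr0n 1) toFp_nat.
Qed.

End SubfieldTrace.

(** * The characters of the prime field *)

Section Zeta.
Variables (R : realType) (p : nat).
Hypotheses (p_pr : prime p) (p_odd : odd p).
Local Notation z := (zeta R p).
Local Notation ze := (zexp R (p := p)).

Import Order.TTheory Num.Theory.

Lemma p_gt2 : (2 < p)%N.
Proof. by rewrite odd_prime_gt2. Qed.

Lemma zeta_X m : z ^+ m =
  (cos (m%:R * (2 * pi / p%:R)) +i* sin (m%:R * (2 * pi / p%:R)))%C.
Proof.
set t := 2 * pi / p%:R; elim: m => [|m IHm]; first by rewrite !mul0r cos0 sin0.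
rewrite exprSr IHm -[m.+1%:R]natr1 [(_ + 1) * t]mulrDl mul1r cosD sinD.
by apply/eqP; rewrite eq_complex /= eqxx /= addrC.
Qed.

Lemma zeta_p : z ^+ p = 1.
Proof.
have p0 : p%:R != 0 :> R by rewrite pnatr_eq0 -lt0n prime_gt0.
by rewrite zeta_X mulrC divfK // mulr_natl cos2pi sin2pi.
Qed.

Lemma zeta_neq1 : z != 1.
Proof.
have p0 : 0 < p%:R :> R by rewrite ltr0n prime_gt0.
(* The imaginary part sin(2 pi / p) is positive because p > 2. *)
rewrite eq_complex negb_and /= orbC gt_eqF // sin_gt0_pi //.
rewrite divr_gt0 ?mulr_gt0 ?pi_gt0 //= ltr_pdivrMr // mulrC ltr_pM2l ?pi_gt0 //.
by rewrite ltr_nat p_gt2.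
Qed.

Lemma zeta_prim : p.-primitive_root z.
Proof.
have [m zm mp] := prim_order_exists (prime_gt0 p_pr) zeta_p.
case/primeP: p_pr => _ /(_ _ mp)/orP[/eqP m1|/eqP mE]; last by rewrite -[X in X.-primitive_root _]mE.
by move: zeta_neq1 (prim_expr_order zm); rewrite m1 expr1 => /eqP.
Qed.

Lemma zexp0 : ze 0 = 1.
Proof. by rewrite /zexp expr0. Qed.

Lemma zexpD a b : ze (a + b) = ze a * ze b.
Proof. by rewrite /zexp /= (expr_mod _ _) ?exprD // Fp_cast // zeta_p. Qed.

Lemma zexp_eq1 a : (ze a == 1) = (a == 0).
Proof.
have a_lt : (a < p)%N by rewrite -[X in (_ < X)%N](Fp_cast p_pr) ltn_ord.
rewrite /zexp -(prim_order_dvd zeta_prim) /dvdn modn_small //.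
Qed.

Lemma zexpN_mul a : ze (- a) * ze a = 1.
Proof. by rewrite -zexpD addNr zexp0. Qed.

Lemma zexp_inj : injective ze.
Proof.
move=> a b ab; apply/eqP; rewrite -subr_eq0 -zexp_eq1 addrC zexpD ab.
by rewrite zexpN_mul.
Qed.

Lemma zexp_p a : ze a ^+ p = 1.
Proof. by rewrite /zexp exprAC zeta_p expr1n. Qed.

Lemma norm_zexp a : `|ze a| = 1.
Proof.
apply/eqP; rewrite -(@pexpr_eq1 _ _ p) ?prime_gt0 // -normrX zexp_p.
by rewrite normr1.
Qed.

Lemma zexp_neq0 a : ze a != 0.
Proof. by rewrite -normr_eq0 norm_zexp oner_eq0. Qed.

Lemma zexpN a : ze (- a) = (ze a)^*.
Proof.
apply: (mulIf (zexp_neq0 a)).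
by rewrite zexpN_mul mulrC -normCK norm_zexp expr1n.
Qed.

(** Raising to the p-th power kills the root of unity and, p being odd, keeps the sign. *)
Lemma sign_zexp_inj (e e' : int) a a' : e = 1 \/ e = -1 -> e' = 1 \/ e' = -1 ->
  e%:~R * ze a = e'%:~R * ze a' -> e = e' /\ a = a'.
Proof.
have signp (d : int) : d = 1 \/ d = -1 -> d ^+ p = d.
  by case=> ->; rewrite ?expr1n // -signr_odd p_odd expr1.
move=> e1 e1' ee'; suff E : e = e'.
  split=> //; apply: zexp_inj; move: ee'; rewrite -E; apply: mulfI.
  by rewrite intr_eq0; case: e1 => ->.
move/(congr1 (fun x => x ^+ p)): ee'; rewrite !exprMn !zexp_p !mulr1 -!rmorphXn /=.
by rewrite !signp // => /intr_inj.
Qed.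

(** Translation by [a] permutes the finite set [A] and multiplies the sum by [ze (f a)], which is
    not 1. *)
Lemma sum_zexp_eq0 (V : finZmodType) (A : {set V}) (f : V -> 'F_p) :
  {in A &, forall x y, x + y \in A} -> {in A &, {morph f : x y / x + y}} ->
  (exists2 a, a \in A & f a != 0) -> \sum_(x in A) ze (f x) = 0.
Proof.
move=> AD fD [a aA fa0].
have aAE : [set a + x | x in A] = A.
  apply/eqP; rewrite eqEcard card_imset ?leqnn ?andbT; last exact: addrI.
  by apply/subsetP => _ /imsetP[x xA ->]; exact: AD.
have S_fa : \sum_(x in A) ze (f x) = ze (f a) * \sum_(x in A) ze (f x).
  rewrite -{1}aAE big_imset /= => [|x y _ _]; last exact: addrI.
  by rewrite mulr_sumr; apply: eq_bigr => x xA; rewrite fD // zexpD.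
apply/eqP; move/eqP: S_fa; rewrite -subr_eq0 -{1}[\sum_(x in A) _]mul1r -mulrBl.
by rewrite mulf_eq0 subr_eq0 eq_sym zexp_eq1 (negPf fa0).
Qed.

Lemma sum_zexp (V : finZmodType) (A : {set V}) (f : V -> 'F_p) :
  {in A &, forall x y, x + y \in A} -> {in A &, {morph f : x y / x + y}} ->
  \sum_(x in A) ze (f x) = #|A|%:R * [forall x in A, f x == 0]%:R.
Proof.
move=> AD fD; case: (boolP [forall x in A, f x == 0]) => [/forall_inP f0|].
  rewrite mulr1 -sum1_card natr_sum; apply: eq_bigr => x xA.
  by rewrite (eqP (f0 x xA)) zexp0.
rewrite negb_forall_in => /exists_inP[a aA fa0].
by rewrite mulr0 sum_zexp_eq0 //; exists a.
Qed.

End Zeta.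

(** * Fourier-reflexive partitions and association schemes *)

Section FourierReflexivity.
Variables (R : realType) (p : nat).
Hypotheses (p_pr : prime p) (p_odd : odd p).
Variables (V : finZmodType) (form : V -> V -> 'F_p).
Hypotheses (formDl : forall z, {morph form^~ z : x y / x + y})
  (formDr : forall z, {morph form z : x y / x + y})
  (form_nondeg : forall x, x != 0 -> exists xi, form xi x != 0).
Local Notation C := R[i].
Local Notation ze := (zexp R (p := p)).
Local Notation chi := (chi R form).
Implicit Types (Omega : {set {set V}}) (U : {set V}) (xi eta : V).

Import Num.Theory.

Let form0r z : form z 0 = 0.
Proof. by apply: (addrI (form z 0)); rewrite -formDr !addr0. Qed.

Let formNr z x : form z (- x) = - form z x.
Proof. by apply/eqP; rewrite -addr_eq0 -formDr addNr form0r. Qed.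

Definition Fourier (f : V -> C) xi : C := \sum_x f x * ze (- form xi x).

Lemma sum_zexp_form x : \sum_xi ze (form xi x) = #|V|%:R * (x == 0)%:R.
Proof.
have := @sum_zexp R p p_pr p_odd V [set: V] (form^~ x).
rewrite cardsT => /(_ (fun _ _ _ _ => in_setT _) (fun a b _ _ => formDl x a b)).
under eq_bigl => y do rewrite inE.
move=> ->; congr (_ * (nat_of_bool _)%:R); apply/forall_inP/eqP => [form0|-> y _].
  apply/eqP; apply/negPn/negP => /form_nondeg[xi]; apply/negP; rewrite negbK.
  by rewrite form0 ?inE.
by rewrite form0r.
Qed.

Lemma Fourier_inversion f y :
  \sum_xi Fourier f xi * ze (form xi y) = #|V|%:R * f y.
Proof.
under eq_bigr => xi _ do rewrite mulr_suml.
rewrite exchange_big (bigD1 y) //= [X in _ + X]big1 => [|x xy].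
  under eq_bigr => xi _ do rewrite -mulrA zexpN_mul // mulr1.
  by rewrite addr0 sumr_const mulr_natl.
under eq_bigr => xi _ do rewrite -mulrA -zexpD // addrC -formNr -formDr.
by rewrite -mulr_sumr sum_zexp_form subr_eq0 eq_sym (negPf xy) !mulr0.
Qed.

Lemma Fourier_inj f g : Fourier f =1 Fourier g -> f =1 g.
Proof.
move=> fg y; have V0 : #|V|%:R != 0 :> C.
  by rewrite pnatr_eq0 -lt0n; apply/card_gt0P; exists 0.
apply: (mulfI V0); rewrite -!Fourier_inversion.
by apply: eq_bigr => xi _; rewrite fg.
Qed.

Lemma chi_Fourier xi U : chi xi U = Fourier (fun x => (x \in U)%:R) xi.
Proof.
rewrite /Defs.chi /Fourier [LHS]big_mkcond; apply: eq_bigr => x _ /=.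
by case: ifP; rewrite ?mul1r ?mul0r.
Qed.

(** * Functions constant on cells and the character table of a partition *)

Section Partition.
Variable Omega : {set {set V}}.
Hypothesis partO : partition Omega [set: V].

Let tiO : trivIset Omega. Proof. by case/and3P: partO. Qed.
Let coverO x : x \in cover Omega.
Proof. by case/and3P: partO => /eqP -> _ _; rewrite inE. Qed.

Definition dual_rel xi eta := [forall U in Omega, chi xi U == chi eta U].

Lemma dual_relP xi eta :
  reflect {in Omega, chi xi =1 chi eta} (dual_rel xi eta).
Proof. by apply: (iffP forall_inP) => E U /E /eqP. Qed.

(** Functions constant on the cells are encoded as functions of the block [pblock Omega x]; their
    transforms are the combinations of the characters of the cells. *)
Lemma Fourier_pblock (alpha : {set V} -> C) xi :
  Fourier (fun x => alpha (pblock Omega x)) xi =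
  \sum_(U in Omega) alpha U * chi xi U.
Proof.
rewrite /Fourier (eq_bigl (fun x => x \in [set: V])) => [|x]; last by rewrite inE.
rewrite (set_partition_big _ partO) /=.
apply: eq_bigr => U UO; rewrite /Defs.chi mulr_sumr.
by apply: eq_bigr => x xU; rewrite (def_pblock tiO UO xU).
Qed.

Local Notation dual := (dual_partition R form Omega).

(** A chosen point of the j-th dual cell; dual cells are nonempty, so the default 0 is never
    taken. *)
Let rep (j : 'I_#|dual|) : V := odflt 0 [pick x in enum_val j].

Lemma rep_ex xi : exists j, {in Omega, chi (rep j) =1 chi xi}.
Proof.
pose P := [set eta in [set: V] | dual_rel xi eta].
have PD : P \in dual by apply/imsetP; exists xi; rewrite ?inE.
exists (enum_rank_in PD P); apply/dual_relP.
rewrite /rep enum_rankK_in //; case: pickP => [x|/(_ xi)].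
  rewrite !inE /= => /dual_relP E; by apply/dual_relP => U UO; rewrite E.
by rewrite !inE /= => /dual_relP[].
Qed.

(** Acting on row vectors, this matrix takes the values of a function on the cells to the values of
    its transform on the dual cells. *)
Definition char_mx : 'M[C]_(#|Omega|, #|dual|) :=
  \matrix_(i, j) chi (rep j) (enum_val i).

Lemma char_mx_mul (v : 'rV[C]_#|Omega|) j :
  (v *m char_mx) 0 j = \sum_i v 0 i * chi (rep j) (enum_val i).
Proof. by rewrite mxE; apply: eq_bigr => i _; rewrite mxE. Qed.

Lemma coef_ex (v : 'rV[C]_#|Omega|) :
  exists alpha : {set V} -> C, forall i, alpha (enum_val i) = v 0 i.
Proof.
exists (fun U => \sum_(i | enum_val i == U) v 0 i) => i.
rewrite (big_pred1 i) // => j; exact: (inj_eq enum_val_inj).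
Qed.

(* A vanishing combination of rows gives a function that is constant on the
   cells of Omega and has Fourier transform 0. *)
Lemma char_mx_free : row_free char_mx.
Proof.
rewrite -kermx_eq0; apply/rowV0P => v /sub_kermxP vM.
have [alpha va] := coef_ex v.
have F0 xi : Fourier (fun x => alpha (pblock Omega x)) xi = Fourier (fun=> 0) xi.
  have [j jxi] := rep_ex xi.
  rewrite Fourier_pblock [RHS]big1 => [|x _]; last by rewrite mul0r.
  transitivity ((v *m char_mx) 0 j); last by rewrite vM mxE.
  rewrite char_mx_mul big_enum_val; apply: eq_bigr => i _.
  by rewrite va jxi ?enum_valP.
apply/rowP => i; rewrite mxE -va.
have /set0Pn[x xU] : enum_val i != set0.
  by apply: contraTneq (enum_valP i) => ->; case/and3P: partO.
by rewrite -(def_pblock tiO (enum_valP i) xU) (Fourier_inj F0).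
Qed.

Lemma leq_card_dual : (#|Omega| <= #|dual|)%N.
Proof.
by have := char_mx_free; rewrite /row_free => /eqP <-; exact: rank_leq_col.
Qed.

(** When the numbers of cells agree, [char_mx] is square with independent rows, hence invertible.
    Solving for the prescribed transform gives a function constant on the cells, which is [f] by
    injectivity of the Fourier transform. *)
Lemma Fourier_const_on_cells (f : V -> C) : #|dual| = #|Omega| ->
  (forall xi eta, dual_rel xi eta -> Fourier f xi = Fourier f eta) ->
  exists alpha : {set V} -> C, forall x, f x = alpha (pblock Omega x).
Proof.
move=> dO fconst.
have /row_fullP[B BM] : row_full char_mx.
  by rewrite /row_full [X in _ == X]dO; exact: char_mx_free.
have [alpha va] := coef_ex ((\row_j Fourier f (rep j)) *m B).
exists alpha; apply: Fourier_inj => xi; rewrite Fourier_pblock.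
have [j jxi] := rep_ex xi.
have -> : Fourier f xi = Fourier f (rep j).
  by apply: fconst; apply/dual_relP => U /jxi.
transitivity (((\row_j Fourier f (rep j)) *m B *m char_mx) 0 j).
  by rewrite -mulmxA BM mulmx1 mxE.
rewrite char_mx_mul [RHS]big_enum_val; apply: eq_bigr => i _.
by rewrite va jxi ?enum_valP.
Qed.

(** A label that determines all characters refines the dual partition, so there are at most as many
    dual cells as labels; [leq_card_dual] gives the other inequality. *)
Lemma card_dual_factor (T : finType) (L : V -> T) :
  {in Omega, forall U xi eta, L xi = L eta -> chi xi U = chi eta U} ->
  (#|L @: [set: V]| <= #|Omega|)%N -> #|dual| = #|Omega|.
Proof.
move=> chiL LO; apply/eqP; rewrite eqn_leq leq_card_dual andbT (leq_trans _ LO) //.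
pose cls xi := [set eta in [set: V] | dual_rel xi eta].
(* The class of any point with label [l]; the default 0 only concerns labels that are not
   attained. *)
pose g l := cls (odflt 0 [pick x | L x == l]).
suff sub : dual \subset g @: (L @: [set: V]).
  exact: leq_trans (subset_leq_card sub) (leq_imset_card _ _).
apply/subsetP => _ /imsetP[xi _ ->]; apply/imsetP; exists (L xi).
  by rewrite imset_f ?inE.
apply/setP => eta; rewrite !inE /=.
case: pickP => [x /eqP Lx|/(_ xi)]; last by rewrite eqxx.
by apply/dual_relP/dual_relP => E U UO; rewrite -E //; apply: chiL.
Qed.

End Partition.

(** * From Fourier-reflexivity to the association scheme *)

Section Scheme.
Variable Omega : {set {set V}}.
Hypothesis refO : Fourier_reflexive R form Omega.

Let partO : partition Omega [set: V]. Proof. by case: refO. Qed.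
Let tiO : trivIset Omega. Proof. by case/and3P: partO. Qed.
Let coverO x : x \in cover Omega.
Proof. by case/and3P: partO => /eqP -> _ _; rewrite inE. Qed.
Let cell_neq0 U : U \in Omega -> exists x, x \in U.
Proof.
by move=> UO; apply/set0Pn; apply: contraTneq UO => ->; case/and3P: partO.
Qed.

(** Integer values are needed for the counts of a scheme; equality is tested in the complex numbers,
    where the natural numbers embed. *)
Lemma same_cell_eq (g : V -> nat) U x y :
  (forall xi eta, dual_rel Omega xi eta ->
     Fourier (fun x => (g x)%:R) xi = Fourier (fun x => (g x)%:R) eta) ->
  U \in Omega -> x \in U -> y \in U -> g x = g y.
Proof.
move=> gconst UO xU yU; case: refO => _ _ dO.
have [alpha ga] := Fourier_const_on_cells partO dO gconst.
apply/eqP; rewrite -(eqr_nat C) !ga.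
by rewrite (def_pblock tiO UO xU) (def_pblock tiO UO yU).
Qed.

Lemma Fourier_opp U xi : Fourier (fun x => (- x \in U)%:R) xi = (chi xi U)^*.
Proof.
rewrite chi_Fourier /Fourier rmorph_sum (reindex_inj oppr_inj) /=.
apply: eq_bigr => x _; rewrite opprK rmorphM rmorph_nat formNr opprK /=.
by rewrite -zexpN // opprK.
Qed.

(** The indicator of -U has the conjugate transform, which is constant on dual cells, so -U is a
    union of cells for every cell U. Using this for [A] and for the block of [- a] shows that -A is
    a single cell. *)
Lemma opp_cell A : A \in Omega ->
  exists2 B, B \in Omega & forall x, (x \in B) = (- x \in A).
Proof.
move=> AO; have [a aA] := cell_neq0 AO.
have opp_sat U x y : U \in Omega -> forall W, W \in Omega -> x \in W -> y \in W ->
    - x \in U -> - y \in U.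
  move=> UO W WO xW yW xU.
  have E := @same_cell_eq (fun x => - x \in U) W x y _ WO xW yW.
  (* Membership is read as a number 0 or 1, so that [same_cell_eq] applies to it. *)
  suff : 1%N = (- y \in U) by case: (- y \in U).
  by rewrite -E ?xU // => xi eta /dual_relP E'; rewrite !Fourier_opp E'.
have BO : pblock Omega (- a) \in Omega by rewrite pblock_mem.
have aB : - a \in pblock Omega (- a) by rewrite mem_pblock.
exists (pblock Omega (- a)) => // x; apply/idP/idP => xP.
  by apply: (opp_sat A (- a) x AO _ BO) => //; rewrite opprK.
by rewrite -[x]opprK; apply: (opp_sat _ a (- x) BO A AO).
Qed.

(** The convolution of the two indicator functions at [w]; on a cell this is an intersection number
    of the scheme. *)
Definition conv_number (A B : {set V}) w := #|[set a in A | w - a \in B]|.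

Lemma conv_numberC A B w : conv_number A B w = conv_number B A w.
Proof.
rewrite /conv_number -(card_imset _ (subrI w)); apply: eq_card => x.
rewrite !inE; apply/imsetP/andP => [[a]|[xB xA]].
  by rewrite inE => /andP[aA wB] ->; rewrite wB subKr.
by exists (w - x); rewrite ?inE subKr ?xA.
Qed.

Lemma Fourier_conv A B xi :
  Fourier (fun w => (conv_number A B w)%:R) xi = chi xi A * chi xi B.
Proof.
rewrite !chi_Fourier /Fourier [RHS]mulr_suml.
transitivity (\sum_w \sum_a ((a \in A) && (w - a \in B))%:R * ze (- form xi w)).
  apply: eq_bigr => w _; rewrite -mulr_suml -natr_sum; congr (_%:R * _).
  by rewrite /conv_number -sum1_card big_mkcond; apply: eq_bigr => a _; rewrite inE; case: ifP.
rewrite exchange_big; apply: eq_bigr => a _ /=.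
rewrite mulr_sumr (reindex_inj (addrI a)); apply: eq_bigr => b _ /=.
rewrite addrC addKr formDr opprD zexpD // -mulnb natrM -!mulrA; congr (_ * _).
by rewrite mulrCA.
Qed.

(** Transposition of relations is negation of cells. The intersection numbers are convolutions,
    whose transforms are products of characters and so constant on dual cells; by [same_cell_eq]
    they depend only on the cell of [y - x]. *)
Lemma Fourier_reflexive_scheme d : #|Omega| = d.+1 ->
  association_scheme d (relations Omega).
Proof.
move=> cO; pose rel U := [set u : V * V | u.2 - u.1 \in U].
have relE x y U : ((x, y) \in rel U) = (y - x \in U) by rewrite inE.
have rel_inj : injective rel.
  by move=> A B AB; apply/setP => x; rewrite -[x]subr0 -!relE AB.
split.
- split; last by rewrite card_imset.
  apply/and3P; split.
  + rewrite eqEsubset subsetT; apply/subsetP => -[x y] _.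
    apply/bigcupP; exists (rel (pblock Omega (y - x))).
      by apply: imset_f; rewrite pblock_mem.
    by rewrite relE mem_pblock.
  + apply/trivIsetP => _ _ /imsetP[A AO ->] /imsetP[B BO ->] AB.
    have {}AB : A != B by apply: contraNneq AB => ->.
    rewrite -setI_eq0; apply/eqP/setP => -[x y]; rewrite !inE /=.
    have := trivIsetP tiO A B AO BO AB; rewrite -setI_eq0 => /eqP/setP/(_ (y - x)).
    by rewrite !inE.
  + apply/imsetP => -[U UO /setP E]; have [x xU] := cell_neq0 UO.
    by have := E (0, x); rewrite !inE /= subr0 xU.
- apply/imsetP; exists [set 0]; first by case: refO.
  by apply/setP => -[x y]; rewrite !inE /= subr_eq0 eq_sym.
- move=> _ /imsetP[A AO ->]; have [B BO AB] := opp_cell AO.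
  by apply/imsetP; exists B => //; apply/setP => -[x y]; rewrite !inE /= AB opprB.
- move=> _ _ _ /imsetP[A AO ->] /imsetP[B BO ->] /imsetP[W WO ->].
  have [w wW] := cell_neq0 WO; exists (conv_number A B w) => x y.
  rewrite inE /= => xyW.
  have card_conv A' B' :
      #|[set z | ((x, z) \in rel A') && ((z, y) \in rel B')]| = conv_number A' B' (y - x).
    (* The translation of [z] to [z - x] turns the count of intermediate points into a
       convolution. *)
    rewrite /conv_number -(card_imset _ (addIr (- x))); apply: eq_card => a.
    rewrite !inE; apply/imsetP/andP => [[z]|[aA wB]].
      by rewrite !inE /= => /andP[zA zB] ->; rewrite zA opprB addrA subrK.
    by exists (a + x); rewrite ?inE /= addrK ?aA //= opprD addrA addrAC.
  have wE : conv_number A B w = conv_number A B (y - x).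
    apply: (same_cell_eq _ WO) => // xi eta /dual_relP E.
    by rewrite !Fourier_conv !E.
  by rewrite -/(rel A) -/(rel B) !card_conv wE [X in _ /\ X = _]conv_numberC.
Qed.

End Scheme.
End FourierReflexivity.

(** * Trace characters and orthogonal subspaces *)

Section TraceCharacters.
Variables (R : realType) (p k : nat) (Fq : finFieldType).
Hypotheses (p_pr : prime p) (p_odd : odd p) (cardF : #|Fq| = (p ^ k)%N).
Local Notation ze := (zexp R (p := p)).
Local Notation GF := (GF p Fq).
Implicit Types (x y g : Fq) (m l : nat).

Import Num.Theory.

Lemma TrFpD m : {in GF m &, {morph (@TrFp p Fq m) : x y / x + y}}.
Proof.
move=> x y xm ym; rewrite /TrFp (TrD p_pr cardF) (toFpD p_pr cardF) //.
  by rewrite (Tr_GF p_pr cardF) ?dvd1n.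
by rewrite (Tr_GF p_pr cardF) ?dvd1n.
Qed.

Lemma TrFp0 m : TrFp p m (0 : Fq) = 0.
Proof.
apply/eqP; rewrite /TrFp (Tr0 Fq p_pr) (toFp_eq0 p_pr cardF) ?eqxx //.
exact: GF0.
Qed.

Lemma TrFpN m : {in GF m, {morph (@TrFp p Fq m) : x / - x}}.
Proof.
move=> x xm; apply/eqP; rewrite -addr_eq0 -TrFpD ?(GFN p_pr cardF) //.
by rewrite addNr TrFp0.
Qed.

Lemma TrFp_trans m l x : (m %| l)%N -> (0 < m)%N ->
  TrFp p m (Tr p l m x) = TrFp p l x.
Proof. by move=> ml m0; rewrite /TrFp (Tr_trans p_pr cardF) ?dvd1n. Qed.

(** Divide an element of trace 1 by [g]. *)
Lemma TrFp_nontrivial m g : (m %| k)%N -> (0 < m)%N -> g \in GF m -> g != 0 ->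
  exists2 u, u \in GF m & TrFp p m (u * g) != 0.
Proof.
move=> mk m0 gm g0.
have [x xm x1] := Tr_surj p_pr cardF mk (dvd1n m) m0 (GF1 p Fq 1).
exists (x / g); first by rewrite (GFM) ?GFV.
by rewrite divfK // /TrFp x1 (toFp_eq0 p_pr cardF) ?GF1 ?oner_eq0.
Qed.

Lemma sum_TrFp m g : (m %| k)%N -> (0 < m)%N -> g \in GF m ->
  \sum_(u in GF m) ze (TrFp p m (u * g)) = (p ^ m)%:R * (g == 0)%:R.
Proof.
move=> mk m0 gm; rewrite (sum_zexp R p_pr p_odd (f := fun u => TrFp p m (u * g))).
- rewrite (card_GF p_pr cardF) //; congr (_ * (nat_of_bool _)%:R).
  apply/forall_inP/eqP => [g0|-> u _]; last by rewrite mulr0 TrFp0.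
  apply/eqP/negPn/negP => /(TrFp_nontrivial mk m0 gm)[u /g0 /eqP ->].
  by rewrite eqxx.
- exact: (GFD p_pr cardF).
- by move=> x y xm ym; rewrite mulrDl TrFpD ?GFM.
Qed.

Lemma sum_TrFp_k g : \sum_u ze (TrFp p k (u * g)) = (p ^ k)%:R * (g == 0)%:R.
Proof.
rewrite -sum_TrFp ?(k_gt0 cardF) ?(GF_k cardF) //.
by apply: eq_bigl => u; rewrite (GF_k cardF).
Qed.

(** * Orthogonality between a subspace and its trace complement *)

Section Perp.
Variables (s : nat) (K0 : {set Fq}).
Hypothesis K0sub : GFsubspace p s K0.
Local Notation perp := (perp p k K0).

Lemma subspace0 : 0 \in K0. Proof. by case: K0sub. Qed.

Lemma subspaceN x : (- x \in K0) = (x \in K0).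
Proof.
have NK y : y \in K0 -> - y \in K0.
  case: K0sub => _ _ KZ yK; rewrite -mulN1r KZ // (GFN p_pr cardF) //.
  exact: GF1.
by apply/idP/idP => /NK //; rewrite opprK.
Qed.

Lemma perpP y : reflect {in K0, forall z, TrFp p k (z * y) = 0} (y \in perp).
Proof.
have TrGF z : Tr p k 1 (z * y) \in GF 1.
  by rewrite (Tr_GF p_pr cardF) ?dvd1n ?(GF_k cardF).
rewrite inE; apply: (iffP forall_inP) => K z zK.
  by apply/eqP; rewrite /TrFp (toFp_eq0 p_pr cardF) ?K.
by rewrite -(toFp_eq0 p_pr cardF) //; apply/eqP; exact: K.
Qed.

Lemma perp0 : 0 \in perp.
Proof. by apply/perpP => z _; rewrite mulr0 TrFp0. Qed.

Lemma sum_subspace c :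
  \sum_(z in K0) ze (TrFp p k (z * c)) = #|K0|%:R * (c \in perp)%:R.
Proof.
case: K0sub => _ KD _.
rewrite (sum_zexp R p_pr p_odd (f := fun z => TrFp p k (z * c))) //.
  congr (_ * (nat_of_bool _)%:R).
  by apply/forall_inP/perpP => K z /K /eqP.
by move=> x y _ _; rewrite mulrDl TrFpD ?(GF_k cardF).
Qed.

(** Double counting over all [y] and all [z] in [K0]: summing over [z] first detects [y] in [perp],
    summing over [y] first detects [z = - b]. *)
Lemma sum_perp b : #|K0|%:R * (\sum_(y in perp) ze (TrFp p k (y * b))) =
  (p ^ k)%:R * (b \in K0)%:R.
Proof.
transitivity (\sum_y \sum_(z in K0) ze (TrFp p k (y * (z + b)))).
  rewrite mulr_sumr big_mkcond; apply: eq_bigr => y _ /=.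
  under eq_bigr => z _ do
    rewrite mulrDr TrFpD ?(GF_k cardF) // zexpD // [y * z]mulrC.
  rewrite -mulr_suml sum_subspace; case: ifP => _; first by rewrite mulr1.
  by rewrite mulr0 mul0r.
rewrite exchange_big; under eq_bigr => z _ do rewrite sum_TrFp_k addr_eq0.
rewrite -mulr_sumr -subspaceN; congr (_ * _); case: (boolP (- b \in K0)) => bK.
  rewrite (bigD1 (- b)) //= eqxx big1 ?addr0 // => z /andP[_ /negPf ->] //.
rewrite big1 // => z zK; case: eqP => // zb; by rewrite -zb zK in bK.
Qed.

Lemma card_perp : (#|K0| * #|perp|)%N = (p ^ k)%N.
Proof.
apply/eqP; rewrite -(eqr_nat R[i]) natrM; apply/eqP.
have := sum_perp 0; rewrite subspace0 mulr1 => <-; congr (_ * _).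
under eq_bigr => y _ do rewrite mulr0 TrFp0 zexp0.
by rewrite sumr_const.
Qed.

Lemma card_subspace_gt0 : (0 < #|K0|)%N.
Proof. by apply/card_gt0P; exists 0; exact: subspace0. Qed.

Lemma card_perp_gt0 : (0 < #|perp|)%N.
Proof. by apply/card_gt0P; exists 0; exact: perp0. Qed.

Lemma perp_full : (perp == [set: Fq]) = (K0 == [set 0]).
Proof.
rewrite eqEcard subsetT cardsT cardF -card_perp -{2}[#|perp|]mul1n.
rewrite leq_pmul2r ?card_perp_gt0 //.
by rewrite [RHS]eq_sym eqEcard sub1set subspace0 cards1.
Qed.

Lemma perp_trivial : (perp == [set 0]) = (K0 == [set: Fq]).
Proof.
rewrite [RHS]eqEcard subsetT cardsT cardF -card_perp -{2}[#|K0|]muln1.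
rewrite leq_pmul2l ?card_subspace_gt0 //.
by rewrite eq_sym eqEcard sub1set perp0 cards1.
Qed.

End Perp.
End TraceCharacters.

(** * The partitions as level sets *)

Local Notation "'tag_ i" := (@Ordinal 6 i isT) (at level 8, i at level 2).

Section Labels.
Variables (p k : nat) (Vn : vectType 'F_p) (Fq : finFieldType) (K0 : {set Fq}).
Local Notation vn := (finvect_type Vn).
Local Notation V := (vn * Fq * Fq)%type.
Local Notation perp := (perp p k K0).
Hypotheses (K00 : 0 \in K0) (perp0 : 0 \in perp).

(* The part of V = {0}, B_1, B_2, (the e_i), (the d_i), (the c_i) containing v. *)
Definition tag (v : V) : 'I_6 :=
  if v.2 \notin K0 then 'tag_5 else if v.2 != 0 then 'tag_4 else
  if v.1.1 != 0 then 'tag_3 else if v.1.2 \notin perp then 'tag_2 else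
  if v.1.2 != 0 then 'tag_1 else 'tag_0.

Lemma tag5E v : (tag v == 'tag_5) = (v.2 \notin K0).
Proof. by rewrite /tag; do !case: ifP => //. Qed.

Lemma tag4E v : (tag v == 'tag_4) = (v.2 \in K0 :\ 0).
Proof. by rewrite /tag in_setD1; do !case: ifPn => //; case: (v.2 \in K0); rewrite ?andbF. Qed.

Lemma tag3E v : (tag v == 'tag_3) = (v.2 == 0) && (v.1.1 != 0).
Proof.
rewrite /tag; case: (eqVneq v.2 0) => [->|_]; first by rewrite K00; do !case: ifP.
by do !case: ifP.
Qed.

Lemma tag2E v :
  (tag v == 'tag_2) = [&& v.1.1 == 0, v.1.2 \notin perp & v.2 == 0].
Proof.
rewrite /tag; case: (eqVneq v.2 0) => [->|_]; last by rewrite !andbF; do !case: ifP.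
rewrite K00 ?eqxx ?andbT /=.
by case: (v.1.1 == 0); case: (v.1.2 \in perp); case: (v.1.2 == 0).
Qed.

Lemma tag1E v :
  (tag v == 'tag_1) = [&& v.1.1 == 0, v.1.2 \in perp :\ 0 & v.2 == 0].
Proof.
rewrite /tag in_setD1; case: (eqVneq v.2 0) => [->|_]; last by rewrite !andbF; do !case: ifP.
rewrite K00 ?eqxx ?andbT /=.
by case: (v.1.1 == 0); case: (v.1.2 \in perp); case: (v.1.2 == 0).
Qed.

Lemma tag0E v : (tag v == 'tag_0) = (v == 0).
Proof.
case: v => [[x y] z]; rewrite /tag -[X in _ = (_ == X)]/((0, 0), 0) !xpair_eqE /=.
case: (eqVneq z 0) => [->|_]; last by rewrite !andbF; do !case: ifP.
rewrite K00 andbT; case: (eqVneq x 0) => //= _.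
by case: (eqVneq y 0) => [->|_]; rewrite ?perp0 //; case: (y \in perp).
Qed.

Variables (m : nat) (H : V -> Fq) (P0 : vn -> Fq).
Hypotheses (H_GF : forall v, H v \in GF p Fq m)
  (H_P0 : forall x y, H (x, y, 0) = P0 x) (P00 : P0 0 = 0).

Definition label v : 'I_6 * Fq := (tag v, H v).

Definition label_cell (l : 'I_6 * Fq) : {set V} := [set v | label v == l].

(** On the axis x = 0, z = 0 the only value is 0, so each of {0}, B_1 and B_2 is a single level set
    of the label. *)
Lemma label_H0 v : v.1.1 = 0 -> v.2 = 0 -> H v = 0.
Proof. by case: v => [[x y] z] /= -> ->; rewrite H_P0. Qed.

Lemma cellcE i : cellc K0 H i = label_cell ('tag_5, i).
Proof. by apply/setP => v; rewrite !inE xpair_eqE tag5E. Qed.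

Lemma celldE i : celld K0 H i = label_cell ('tag_4, i).
Proof. by apply/setP => v; rewrite [LHS]inE [RHS]inE xpair_eqE tag4E. Qed.

Lemma celleE i : celle P0 i = label_cell ('tag_3, i).
Proof.
apply/setP => -[[x y] z]; rewrite !inE xpair_eqE tag3E /=.
by case: (eqVneq z 0) => [->|//]; rewrite H_P0.
Qed.

Lemma cellB2E : cellB2 k Vn K0 = label_cell ('tag_2, 0).
Proof.
apply/setP => v; rewrite [LHS]inE [RHS]inE xpair_eqE tag2E.
by case: eqP => //= x0; case: eqP => [z0|]; rewrite ?andbF // label_H0 ?eqxx ?andbT.
Qed.

Lemma cellB1E : cellB1 k Vn K0 = label_cell ('tag_1, 0).
Proof.
apply/setP => v; rewrite [LHS]inE [RHS]inE xpair_eqE tag1E.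
by case: eqP => //= x0; case: eqP => [z0|]; rewrite ?andbF // label_H0 ?eqxx ?andbT.
Qed.

Lemma cell0E : [set 0] = label_cell ('tag_0, 0).
Proof.
apply/setP => v; rewrite [LHS]inE [RHS]inE xpair_eqE tag0E.
by case: eqP => [->|//]; rewrite label_H0 ?eqxx.
Qed.

(** Every cell is a level set of the label, and level sets through a point are nonempty, which
    matches the removal of [set0]. *)
Lemma OmegaE : Omega k K0 m H P0 = preim_partition label [set: V].
Proof.
have fibreE v : [set w in [set: V] | label v == label w] = label_cell (label v).
  by apply/setP => w; rewrite !inE eq_sym.
have cell_fibre l w : w \in label_cell l ->
    label_cell l \in preim_partition label [set: V].
  by rewrite inE => /eqP <-; rewrite -fibreE; apply: imset_f; rewrite inE.
rewrite /Omega cell0E cellB1E cellB2E.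
apply/setP => U; rewrite in_setD1; apply/andP/imsetP.
  case=> /set0Pn[w wU] UO.
  suff [l Ul] : exists l, U = label_cell l.
    exists w; rewrite ?inE // fibreE Ul.
    by move: wU; rewrite Ul inE => /eqP ->.
  move: UO; rewrite !in_setU => /orP[/orP[/orP[]|]|].
  - rewrite !inE -orbA => /or3P[] /eqP ->; by eexists.
  - by case/imsetP => i _ ->; rewrite celleE; eexists.
  - by case/imsetP => i _ ->; rewrite celldE; eexists.
  - by case/imsetP => i _ ->; rewrite cellcE; eexists.
case=> v _ ->; rewrite fibreE; split.
  by apply/set0Pn; exists v; rewrite inE.
rewrite !in_setU; case E : (label v) => [t i].
have iE : H v = i by case: E.
have iG : i \in GF p Fq m by rewrite -iE H_GF.
move: E => /eqP; rewrite xpair_eqE => /andP[tE _].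
(* The six parts are now gone through from c down to {0}; in the last three, [label_H0] forces the
   value 0. *)
have [T|T] := boolP (v.2 \notin K0).
  have -> : t = 'tag_5 by apply/eqP; rewrite -(eqP tE) tag5E.
  by rewrite -cellcE imset_f ?orbT.
have [T4|T4] := boolP (v.2 \in K0 :\ 0).
  have -> : t = 'tag_4 by apply/eqP; rewrite -(eqP tE) tag4E.
  by rewrite -celldE imset_f ?orbT.
have v20 : v.2 = 0.
  by apply/eqP; move: T T4; rewrite in_setD1 negbK => ->; rewrite andbT negbK.
have [T3|/negPn/eqP v10] := boolP (v.1.1 != 0).
  have -> : t = 'tag_3 by apply/eqP; rewrite -(eqP tE) tag3E v20 eqxx.
  by rewrite -celleE imset_f ?orbT.
have -> : i = 0 by rewrite -iE label_H0.
have [T2|T2] := boolP (v.1.2 \notin perp).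
  have -> : t = 'tag_2 by apply/eqP; rewrite -(eqP tE) tag2E T2 v10 v20 !eqxx.
  by rewrite !inE !eqxx ?orbT.
have [T1|T1] := boolP (v.1.2 \in perp :\ 0).
  have -> : t = 'tag_1 by apply/eqP; rewrite -(eqP tE) tag1E T1 v10 v20 !eqxx.
  by rewrite !inE !eqxx ?orbT.
have -> : t = 'tag_0.
  apply/eqP; rewrite -(eqP tE) tag0E; case: (v) v10 v20 T1 T2 => [[x y] z] /= -> ->.
  by rewrite in_setD1 negbK => + yp; rewrite yp andbT negbK => /eqP ->.
by rewrite !inE !eqxx ?orbT.
Qed.

End Labels.

Lemma card_preim_partition (T T' : finType) (f : T -> T') :
  #|preim_partition f [set: T]| = #|f @: [set: T]|.
Proof.
pose cls (y : T') := [set x in [set: T] | y == f x].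
have -> : preim_partition f [set: T] = cls @: (f @: [set: T]).
  by rewrite /preim_partition /equivalence_partition -imset_comp.
rewrite card_in_imset // => _ _ /imsetP[x _ ->] /imsetP[y _ ->] /setP/(_ x).
by rewrite !inE eqxx => /esym/eqP.
Qed.

Lemma card_label_image (T : finType) (Fq : finFieldType) (tg : T -> 'I_6) (h : T -> Fq) :
  #|(fun v => (tg v, h v)) @: [set: T]| =
  (\sum_(t < 6) #|h @: [set v | tg v == t]|)%N.
Proof.
rewrite -sum1_card (partition_big (fun l => l.1) xpredT) //=; apply: eq_bigr => t _.
have pair_inj : injective (fun a : Fq => (t, a)) by move=> a b [].
rewrite sum1dep_card -[RHS](card_imset _ pair_inj).
apply: eq_card => -[t' a]; rewrite !inE /=; apply/andP/imsetP.
  by case=> /imsetP[v _ [-> ->]] /eqP tv; exists (h v); rewrite ?tv // imset_f // inE tv.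
case=> _ /imsetP[v + ->] [-> ->]; rewrite inE => /eqP <-.
by rewrite eqxx; split=> //; apply/imsetP; exists v.
Qed.

(** * Fourier transforms of the cells *)

Section MainForm.
Variables (R : realType) (p k : nat) (Fq : finFieldType) (Vn : vectType 'F_p).
Variable form : {symmetric finvect_type Vn}.
Hypotheses (p_pr : prime p) (p_odd : odd p) (cardF : #|Fq| = (p ^ k)%N).
Hypothesis form_nd : nondegenerate form.
Local Notation ze := (zexp R (p := p)).
Local Notation vn := (finvect_type Vn).
Local Notation V := (vn * Fq * Fq)%type.

Import Num.Theory.

Lemma form_sym x y : form x y = form y x.
Proof. by rewrite hermC /= expr0 mul1r. Qed.

Lemma form_sep (x : vn) : x != 0 -> exists xi, form xi x != 0.
Proof.
move=> x0; have : x \notin orthov form fullv by rewrite (eqP form_nd) memv0.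
by case/mem_orthovPn => v _ fxv; exists v; rewrite form_sym.
Qed.

Lemma card_vn : #|vn| = (p ^ \dim {:Vn})%N.
Proof.
have := card_vspace (fullv : {vspace vn}); rewrite card_Fp // => <-.
by apply: eq_card => v; rewrite memvf.
Qed.

Lemma sum_form (a : vn) : \sum_x ze (- form a x) = #|vn|%:R * (a == 0)%:R.
Proof.
have := sum_zexp_form R p_pr p_odd (linearDl form) (linearDr form) form_sep (- a).
rewrite oppr_eq0 => <-; apply: eq_bigr => x _.
by rewrite form_sym linearNr.
Qed.

Lemma formVDl (z : V) : {morph (formV k form)^~ z : x y / x + y}.
Proof.
move=> x y; rewrite /formV /= linearDl !mulrDl !(TrFpD p_pr cardF) ?(GF_k cardF) //.
by rewrite [RHS]addrACA; congr (_ + _); rewrite addrACA.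
Qed.

Lemma formV_sym (x y : V) : formV k form x y = formV k form y x.
Proof. by rewrite /formV form_sym (mulrC x.1.2) (mulrC x.2). Qed.

Lemma formVDr (z : V) : {morph formV k form z : x y / x + y}.
Proof. by move=> x y; rewrite !(formV_sym z) formVDl. Qed.

Lemma formV_sep (v : V) : v != 0 -> exists xi, formV k form xi v != 0.
Proof.
case: v => [[x y] z]; have [x0 | /form_sep[a ax] _] := eqVneq x 0; last first.
  exists (a, 0, 0); by rewrite /formV /= !mul0r !(TrFp0 p_pr cardF) !addr0.
have [y0 | y0 _] := eqVneq y 0; last first.
  have [u _ uy] := TrFp_nontrivial p_pr cardF (dvdnn k) (k_gt0 cardF) (GF_k cardF y) y0.
  exists (0, u, 0); by rewrite /formV /= linear0l mul0r (TrFp0 p_pr cardF) add0r addr0.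
rewrite x0 y0 => z0.
have {}z0 : z != 0 by apply: contraNneq z0 => ->.
have [u _ uz] := TrFp_nontrivial p_pr cardF (dvdnn k) (k_gt0 cardF) (GF_k cardF z) z0.
exists (0, 0, u); by rewrite /formV /= linear0l mul0r (TrFp0 p_pr cardF) !add0r.
Qed.

Lemma zexp_formV (a x : vn) (b c y z : Fq) :
  ze (- formV k form (a, b, c) (x, y, z)) =
  ze (- form a x) * ze (TrFp p k (y * - b)) * ze (TrFp p k (z * - c)).
Proof.
rewrite /formV /= !opprD !zexpD //.
by rewrite !mulrN -!(TrFpN p_pr cardF) ?(GF_k cardF) // [y * b]mulrC [z * c]mulrC.
Qed.

Lemma sum_triple (S : {set Fq}) (f : V -> R[i]) :
  \sum_(v : V | v.2 \in S) f v = \sum_(z in S) \sum_x \sum_y f (x, y, z).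
Proof.
under [RHS]eq_bigr => z _ do rewrite pair_big /=.
rewrite exchange_big /= pair_big /=.
by apply: eq_big => -[[x y] z].
Qed.

(** * Character sums of the function H over a range of third coordinates *)

Section TwistedSum.
Variables (s : nat) (P : Fq -> vn -> Fq).
Hypotheses (sk : (s %| k)%N) (P_GF : forall z x, P z x \in GF p Fq s).
Local Notation H := (Hfun (p := p) k s P).

Let s_gt0 : (0 < s)%N. Proof. exact: dvdn_gt0 (k_gt0 cardF) sk. Qed.

Lemma Hfun_GF v : H v \in GF p Fq s.
Proof. by rewrite /Hfun (GFD p_pr cardF) ?(Tr_GF p_pr cardF) ?(GF_k cardF). Qed.

Definition twisted_sum (S : {set Fq}) (t : Fq) (xi : V) : R[i] :=
  \sum_(v : V | v.2 \in S) ze (TrFp p s (t * H v)) * ze (- formV k form xi v).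

(** The sum over x is a Walsh coefficient, and the sum over y is a full character sum that vanishes
    unless [t * z = b]. *)
Lemma twisted_sumE S t (a : vn) (b c : Fq) : t \in GF p Fq s ->
  twisted_sum S t (a, b, c) =
  \sum_(z in S) ze (TrFp p k (z * - c)) * Walsh R form (component s (P z) t) a
     * ((p ^ k)%:R * (t * z == b)%:R).
Proof.
move=> tG; rewrite /twisted_sum sum_triple; apply: eq_bigr => z _.
rewrite mulr_sumr mulr_suml; apply: eq_bigr => x _.
(* The indicator of [t * z = b] is expanded back into its sum over y, so that both sides can be
   compared term by term. *)
rewrite -subr_eq0 -(sum_TrFp_k R p_pr p_odd cardF) mulr_sumr.
apply: eq_bigr => y _; rewrite zexp_formV /Hfun /=.
rewrite mulrDr (TrFpD p_pr cardF) ?GFM ?(Tr_GF p_pr cardF) ?(GF_k cardF) //.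
rewrite -TrZ // (TrFp_trans p_pr cardF) // /component zexpD // zexpD //.
rewrite [y * (_ - _)]mulrBr (TrFpD p_pr cardF) ?(GF_k cardF) // zexpD // mulrN.
rewrite [y * (t * z)]mulrCA.
ring.
Qed.

Lemma Walsh_component0 z (a : vn) :
  Walsh R form (component s (P z) 0) a = #|vn|%:R * (a == 0)%:R.
Proof.
rewrite -sum_form; apply: eq_bigr => x _.
by rewrite /component mul0r (TrFp0 p_pr cardF) add0r.
Qed.

Lemma twisted_sum0 S (a : vn) (b c : Fq) : twisted_sum S 0 (a, b, c) =
  #|vn|%:R * (a == 0)%:R * ((p ^ k)%:R * (b == 0)%:R)
  * \sum_(z in S) ze (TrFp p k (z * - c)).
Proof.
rewrite twisted_sumE ?GF0 // mulr_sumr; apply: eq_bigr => z _.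
by rewrite Walsh_component0 mul0r [0 == b]eq_sym; ring.
Qed.

Variables (G : Fq -> vn -> Fq) (eps : Fq -> Fq -> int).
Hypothesis P_scale : forall z c, c \in GFstar p Fq s -> P (c * z) =1 P z.
Hypothesis P_Walsh : forall z t b, t \in GFstar p Fq s ->
  Walsh R form (component s (P z) t) b =
  (eps z t)%:~R * bent_norm R Vn * ze (TrFp p s (t^-1 * G z b)).

(** At this point the function H built from G takes the value G^(b)(a) - Tr(b c), the exponent
    produced by inversion type. *)
Definition dual_point (xi : V) : V := (xi.1.1, - xi.2, xi.1.2).

(** Only z = b / t survives. It lies in [S] exactly when b does, and P^(b/t) = P^(b) by scale
    invariance. *)
Lemma twisted_sum_star (S : {set Fq}) t (xi : V) : t \in GFstar p Fq s ->
  (forall z, (t^-1 * z \in S) = (z \in S)) ->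
  (forall z x, G z x \in GF p Fq s) ->
  twisted_sum S t xi =
  (xi.1.2 \in S)%:R * (p ^ k)%:R * (eps xi.1.2 t)%:~R * bent_norm R Vn
    * ze (TrFp p s (t^-1 * Hfun k s G (dual_point xi))).
Proof.
case: xi => [[a b] c] tG S_scale G_GF; have [tG' t0] := GFstarP _ _ _ tG.
have tVG := GFstarV tG; have [tVG' _] := GFstarP _ _ _ tVG.
rewrite twisted_sumE // big_mkcond (bigD1 (t^-1 * b)) //= [X in _ + X]big1 => [|z zb].
  rewrite addr0 S_scale mulVKf // eqxx mulr1.
  have -> : Walsh R form (component s (P (t^-1 * b)) t) a =
            Walsh R form (component s (P b) t) a.
    by apply: eq_bigr => x _; rewrite /component P_scale.
  rewrite P_Walsh // /Hfun /dual_point /= mulrDr.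
  rewrite (TrFpD p_pr cardF) ?GFM ?(Tr_GF p_pr cardF) ?(GF_k cardF) // zexpD //.
  rewrite -TrZ // (TrFp_trans p_pr cardF) // [- c * b]mulrC [t^-1 * (b * - c)]mulrA.
  case: ifP => _; rewrite ?mul1r ?mul0r //.
  have perm (A e N B q : R[i]) : A * (e * N * B) * q = q * e * N * (B * A) by ring.
  exact: perm.
case: ifP => // _; case: eqP => [tz|]; last by rewrite mulr0 mulr0.
by rewrite -tz mulKf // eqxx in zb.
Qed.

End TwistedSum.

(** * The characters of the cells factor through the dual label *)

Section Factor.
Variables (s : nat) (P G : Fq -> vn -> Fq) (eps : Fq -> Fq -> int).
Hypotheses (sk : (s %| k)%N) (P_GF : forall z x, P z x \in GF p Fq s)
  (G_GF : forall z x, G z x \in GF p Fq s).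
Hypothesis P_scale : forall z c, c \in GFstar p Fq s -> P (c * z) =1 P z.
Hypothesis P_Walsh : forall z t b, t \in GFstar p Fq s ->
  Walsh R form (component s (P z) t) b =
  (eps z t)%:~R * bent_norm R Vn * ze (TrFp p s (t^-1 * G z b)).
Variable K0 : {set Fq}.
Hypothesis K0sub : GFsubspace p s K0.
Hypothesis epsK1 : {in ~: K0 &, forall z1 z2, {in GFstar p Fq s, eps z1 =1 eps z2}}.
Hypothesis epsK0 : {in K0 :\ 0 &, forall z1 z2, {in GFstar p Fq s, eps z1 =1 eps z2}}.
Hypothesis P00 : P 0 0 = 0.

Variables (s' : nat) (gamma : Fq).
Hypotheses (s's : (s' %| s)%N) (gammaG : gamma \in GFstar p Fq s).

Local Notation H' := (Hfun' (p := p) k s s' gamma P).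
Local Notation HG' := (Hfun' (p := p) k s s' gamma^-1 G).
Local Notation chi := (chi R (formV k form)).
Local Notation tag := (tag k K0).
Local Notation perp := (perp p k K0).

Let s_gt0 : (0 < s)%N. Proof. exact: dvdn_gt0 (k_gt0 cardF) sk. Qed.
Let s'_gt0 : (0 < s')%N. Proof. exact: dvdn_gt0 s_gt0 s's. Qed.
Let K00 : 0 \in K0. Proof. exact: subspace0 K0sub. Qed.
Let perp_0 : 0 \in perp. Proof. exact: (perp0 p_pr cardF). Qed.

Lemma Hfun'_GF gamma' (Q : Fq -> vn -> Fq) v : gamma' \in GF p Fq s ->
  (forall z x, Q z x \in GF p Fq s) -> Hfun' (p := p) k s s' gamma' Q v \in GF p Fq s'.
Proof. by move=> gG QG; rewrite /Hfun' (Tr_GF p_pr cardF) ?GFM ?Hfun_GF. Qed.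

Lemma Hfun'_P0' gamma' (Q : Fq -> vn -> Fq) x y :
  Hfun' (p := p) k s s' gamma' Q (x, y, 0) = P0' s s' gamma' Q x.
Proof. by rewrite /Hfun' /Hfun /= mulr0 (Tr0 Fq p_pr) addr0. Qed.

Lemma P0'0 gamma' (Q : Fq -> vn -> Fq) : Q 0 0 = 0 -> P0' (p := p) s s' gamma' Q 0 = 0.
Proof. by move=> Q0; rewrite /P0' Q0 mulr0 (Tr0 Fq p_pr). Qed.

(* The cells of the dual partition are the level sets of the label of the
   family (G^(z)) and 1 / gamma, after (a, b, c) |-> (a, -c, b). *)
Definition dual_label xi := label k K0 HG' (dual_point xi).

(** These ranges of the third coordinate carry the c, d and e cells; all three are stable under
    scaling by [GFstar s], as [twisted_sum_star] requires. *)
Definition third_sets : seq {set Fq} := [:: ~: K0; K0 :\ 0; [set 0]].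

Lemma third_set_scale (S : {set Fq}) t z : S \in third_sets -> t \in GFstar p Fq s ->
  (t * z \in S) = (z \in S).
Proof.
move=> SK /[dup] tG /GFstarP[tG' t0].
have K0t : (t * z \in K0) = (z \in K0).
  case: K0sub => _ _ KZ; apply/idP/idP => zK; last exact: KZ.
  by rewrite -(mulKf t0 z) KZ // GFV.
move: SK; rewrite !inE => /or3P[] /eqP ->; rewrite !inE ?K0t //.
  by rewrite mulf_eq0 (negPf t0).
by rewrite mulf_eq0 (negPf t0).
Qed.

Lemma dual_label_mem (S : {set Fq}) xi eta : S \in third_sets ->
  dual_label xi = dual_label eta -> (xi.1.2 \in S) = (eta.1.2 \in S).
Proof.
move=> SK [tE _]; move: SK; rewrite !inE => /or3P[] /eqP ->.
- by rewrite !in_setC -(tag5E k K0 (dual_point xi)) -(tag5E k K0 (dual_point eta)) tE.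
- by rewrite -(tag4E k K0 (dual_point xi)) -(tag4E k K0 (dual_point eta)) tE.
have T zeta : (zeta.1.2 \in [set 0]) =
    ~~ ((tag (dual_point zeta) == 'tag_5) || (tag (dual_point zeta) == 'tag_4)).
  rewrite tag5E tag4E in_setD1 in_set1 /dual_point /=.
  by case: eqP => [->|_]; rewrite ?K00 //=; case: (_ \in K0).
by rewrite !T tE.
Qed.

(** This serves the trivial character u = 0: by [twisted_sum0] its sum vanishes unless a = b = 0,
    and then c matters only through the two conditions stated here. *)
Lemma dual_label_zero xi eta : dual_label xi = dual_label eta ->
  [/\ (xi.1.1 == 0) && (xi.1.2 == 0) = (eta.1.1 == 0) && (eta.1.2 == 0) &
      (xi.1.1 == 0) && (xi.1.2 == 0) ->
        (- xi.2 \in perp) = (- eta.2 \in perp) /\ (- xi.2 == 0) = (- eta.2 == 0)].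
Proof.
move=> E; have [tE _] := E.
have b0 : (xi.1.2 == 0) = (eta.1.2 == 0).
  by rewrite -!in_set1; apply: (dual_label_mem _ E); rewrite !inE eqxx !orbT.
have a0 := tag3E k K00 (dual_point xi); rewrite tE (tag3E k K00) /= b0 in a0.
have {}a0 : (xi.1.1 == 0) && (xi.1.2 == 0) = (eta.1.1 == 0) && (eta.1.2 == 0).
  rewrite b0; case: (eta.1.2 == 0) a0; rewrite ?andbF ?andbT //=.
  by case: (_ == _); case: (_ == _).
split=> //; move=> ab; have ab' := ab; rewrite a0 in ab'.
case/andP: ab => a1 b1; case/andP: ab' => a2 b2.
have := tag2E k K00 (dual_point xi); rewrite tE (tag2E k K00) /= a1 b1 a2 b2 !andbT.
move/negb_inj => pE; split=> //.
have := tag1E k K00 (dual_point xi); rewrite tE (tag1E k K00) /= a1 b1 a2 b2 !andbT.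
rewrite !in_setD1 pE.
case: (boolP (_ \in perp)) => yP; rewrite ?andbT; first by move/negb_inj.
have nz y : y \notin perp -> (y == 0) = false.
  by apply: contraNF => /eqP ->.
by rewrite !nz ?pE.
Qed.

Lemma third_set_eps (S : {set Fq}) (xi eta : V) t : S \in third_sets -> t \in GFstar p Fq s ->
  xi.1.2 \in S -> eta.1.2 \in S -> eps xi.1.2 t = eps eta.1.2 t.
Proof.
move=> + tG; rewrite 3!inE => /or3P[] /eqP ->; first by move=> x1 x2; apply: epsK1.
  by move=> x1 x2; apply: epsK0.
by rewrite !in_set1 => /eqP -> /eqP ->.
Qed.

(** Orthogonality evaluates the sums over [K0] and over the whole field; the remaining ones are
    differences of these and of the term at 0. *)
Lemma sum_third_set (S : {set Fq}) (xi eta : V) : S \in third_sets ->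
  (- xi.2 \in perp) = (- eta.2 \in perp) -> (- xi.2 == 0) = (- eta.2 == 0) ->
  \sum_(z in S) ze (TrFp p k (z * - xi.2)) =
  \sum_(z in S) ze (TrFp p k (z * - eta.2)).
Proof.
move=> SK pE zE.
have sumK : \sum_(z in K0) ze (TrFp p k (z * - xi.2)) =
            \sum_(z in K0) ze (TrFp p k (z * - eta.2)).
  by rewrite !(sum_subspace R p_pr p_odd cardF K0sub) pE.
move: SK; rewrite !inE => /or3P[] /eqP ->.
- have sumT f : \sum_(z in ~: K0) f z = \sum_z f z - \sum_(z in K0) f z :> R[i].
    apply/esym/eqP; rewrite subr_eq (bigID [in K0]) /= addrC; apply/eqP.
    by congr (_ + _); apply: eq_bigl => z; rewrite inE.
  by rewrite !sumT !(sum_TrFp_k R p_pr p_odd cardF) zE sumK.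
- have sumD f : \sum_(z in K0 :\ 0) f z = \sum_(z in K0) f z - f 0 :> R[i].
    by apply/esym/eqP; rewrite subr_eq (big_setD1 0) //= addrC.
  by rewrite !sumD sumK !mul0r.
- by rewrite !big_set1 !mul0r.
Qed.

Lemma twisted_sum_factor (S : {set Fq}) u xi eta : S \in third_sets -> u \in GF p Fq s' ->
  dual_label xi = dual_label eta ->
  twisted_sum s P S (u * gamma) xi = twisted_sum s P S (u * gamma) eta.
Proof.
move=> SK uG E; have [gG g0] := GFstarP _ _ _ gammaG.
have [u0|u0] := eqVneq u 0.
  have [ab pz] := dual_label_zero E.
  case: xi eta ab pz {E} => [[a b] c] [[a' b'] c'] /= ab pz.
  rewrite u0 mul0r !twisted_sum0 //.
  case: (boolP ((a == 0) && (b == 0))) (ab) (pz) => [/andP[-> ->]|].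
    move=> /esym/andP[-> ->] /(_ isT)[pE zE]; congr (_ * _).
    exact: (sum_third_set (xi := (a, b, c)) (eta := (a', b', c'))).
  rewrite negb_and => + /esym/negbT; rewrite negb_and.
  by move=> /orP[] /negPf -> /orP[] /negPf -> _; rewrite !(mulr0, mul0r).
have ugG : u * gamma \in GFstar p Fq s.
  by apply/GFstarP; rewrite mulf_neq0 // GFM // (GF_dvd s's).
have stable z : ((u * gamma)^-1 * z \in S) = (z \in S).
  by rewrite third_set_scale // GFstarV.
rewrite !(twisted_sum_star sk P_GF P_scale P_Walsh _ ugG stable G_GF).
rewrite (dual_label_mem SK E); case: (boolP (eta.1.2 \in S)) => etaS; last by rewrite !mul0r.
have xiS : xi.1.2 \in S by rewrite (dual_label_mem SK E).
rewrite (third_set_eps SK ugG xiS etaS); congr (_ * ze _).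
have uVG : u^-1 \in GF p Fq s' by rewrite GFV.
(* The multiplier 1 / gamma arises here: [u^-1] lies in the smaller field and comes out of the trace
   to it, while [gamma^-1] stays inside. *)
have T zeta : TrFp p s ((u * gamma)^-1 * Hfun k s G zeta) = TrFp p s' (u^-1 * HG' zeta).
  by rewrite /Hfun' -TrZ // (TrFp_trans p_pr cardF) // invfM mulrA.
by case: E => _ E; rewrite !T E.
Qed.

(** Orthogonality of the characters of [GF s'] detects H' = j, and the trace of u H' to the prime
    field is that of u gamma H by transitivity. *)
Lemma chi_level (S : {set Fq}) j xi : j \in GF p Fq s' ->
  (p ^ s')%:R * chi xi [set v | (v.2 \in S) && (H' v == j)] =
  \sum_(u in GF p Fq s') ze (TrFp p s' (u * - j)) * twisted_sum s P S (u * gamma) xi.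
Proof.
move=> jG; have s'k := dvdn_trans s's sk; have [gG _] := GFstarP _ _ _ gammaG.
have HG v := Hfun'_GF v gG P_GF.
under [RHS]eq_bigr => u _ do rewrite /twisted_sum mulr_sumr.
rewrite exchange_big /Defs.chi mulr_sumr big_mkcond [RHS]big_mkcond.
apply: eq_bigr => v _ /=; rewrite inE; case: (v.2 \in S) => //=.
transitivity (ze (- formV k form xi v) *
    \sum_(u in GF p Fq s') ze (TrFp p s' (u * (H' v - j)))); last first.
  rewrite mulr_sumr; apply: eq_bigr => u uG.
  rewrite mulrBr (TrFpD p_pr cardF) ?GFM ?(GFN p_pr cardF) ?GFM // zexpD // -mulrN.
  have -> : TrFp p s' (u * H' v) = TrFp p s (u * gamma * Hfun k s P v).
    by rewrite /Hfun' -TrZ // (TrFp_trans p_pr cardF) // mulrA.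
  ring.
rewrite (sum_TrFp R p_pr p_odd cardF) ?(GFB p_pr cardF) // subr_eq0.
by case: ifP => _; rewrite ?mulr1 ?mulr0 // mulrC.
Qed.

Lemma chi_level_factor (S : {set Fq}) j xi eta : S \in third_sets ->
  j \in GF p Fq s' -> dual_label xi = dual_label eta ->
  chi xi [set v | (v.2 \in S) && (H' v == j)] =
  chi eta [set v | (v.2 \in S) && (H' v == j)].
Proof.
move=> SK jG E; have p0 : (p ^ s')%:R != 0 :> R[i].
  by rewrite pnatr_eq0 -lt0n expn_gt0 prime_gt0.
apply: (mulfI p0); rewrite !chi_level //; apply: eq_bigr => u uG.
by rewrite (twisted_sum_factor SK uG E).
Qed.

(** With suitable [T] this gives {0}, B_1, B_2, and the points with x = z = 0 that are missing from
    the e cells. *)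
Definition axis (T : {set Fq}) : {set V} :=
  [set v | [&& v.1.1 == 0, v.1.2 \in T & v.2 == 0]].

Lemma chi_axis T xi :
  chi xi (axis T) = \sum_(y in T) ze (TrFp p k (y * - xi.1.2)).
Proof.
have -> : axis T = (fun y => (0, y, 0)) @: T.
  apply/setP => -[[x y] z]; rewrite inE /=; apply/idP/imsetP => [/and3P[]|[y' yT]].
    by move=> /eqP -> yT /eqP ->; exists y.
  by case=> -> -> ->; rewrite !eqxx yT.
rewrite /Defs.chi big_imset /= => [|y y' _ _ []] //.
apply: eq_bigr => y _; case: xi => [[a b] c].
by rewrite zexp_formV linear0r oppr0 mul0r (TrFp0 p_pr cardF) !zexp0 mul1r mulr1.
Qed.

(** By orthogonality these characters depend on the second coordinate b of the argument only through
    b = 0 and b in [K0], and the label sees both. *)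
Lemma chi_axis_factor T xi eta :
  T \in [:: [set: Fq]; perp; ~: perp; perp :\ 0; [set 0]] ->
  dual_label xi = dual_label eta -> chi xi (axis T) = chi eta (axis T).
Proof.
move=> TT E; rewrite !chi_axis.
have b0 : (- xi.1.2 == 0) = (- eta.1.2 == 0).
  rewrite !oppr_eq0 -!in_set1.
  by apply: (dual_label_mem _ E); rewrite !inE eqxx !orbT.
have bK : (xi.1.2 \in K0) = (eta.1.2 \in K0).
  by apply: negb_inj; rewrite -!in_setC; apply: (dual_label_mem _ E); rewrite !inE eqxx.
have sumT : \sum_y ze (TrFp p k (y * - xi.1.2)) = \sum_y ze (TrFp p k (y * - eta.1.2)).
  by rewrite !(sum_TrFp_k R p_pr p_odd cardF) b0.
have sumP : \sum_(y in perp) ze (TrFp p k (y * - xi.1.2)) =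
            \sum_(y in perp) ze (TrFp p k (y * - eta.1.2)).
  have K_gt0 : #|K0|%:R != 0 :> R[i].
    by rewrite pnatr_eq0 -lt0n (card_subspace_gt0 K0sub).
  apply: (mulfI K_gt0); rewrite !(sum_perp R p_pr p_odd cardF K0sub).
  by rewrite !(subspaceN p_pr cardF K0sub) bK.
move: TT; rewrite !inE => /or4P[||| /orP[]] /eqP ->.
- by under eq_bigl do rewrite inE; under [RHS]eq_bigl do rewrite inE.
- exact: sumP.
- have sumC f : \sum_(y in ~: perp) f y = \sum_y f y - \sum_(y in perp) f y :> R[i].
    apply/esym/eqP; rewrite subr_eq (bigID [in perp]) /= addrC; apply/eqP.
    by congr (_ + _); apply: eq_bigl => y; rewrite in_setC.
  by rewrite !sumC sumT sumP.
- have sumD f : \sum_(y in perp :\ 0) f y = \sum_(y in perp) f y - f 0 :> R[i].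
    by apply/esym/eqP; rewrite subr_eq (big_setD1 0) //= addrC.
  by rewrite !sumD sumP !mul0r.
- by rewrite !big_set1 !mul0r.
Qed.

Lemma chi_setD xi (A B : {set V}) : chi xi (A :\: B) = chi xi A - chi xi (A :&: B).
Proof. by apply/esym/eqP; rewrite subr_eq addrC /Defs.chi -big_setID. Qed.

Lemma chi_factor : {in OmegaH' (p := p) k K0 s s' gamma P, forall U xi eta,
  dual_label xi = dual_label eta -> chi xi U = chi eta U}.
Proof.
move=> U UO xi eta E; have [gG _] := GFstarP _ _ _ gammaG.
move: UO; rewrite /OmegaH' /Omega in_setD1 !in_setU => /andP[_].
move=> /orP[/orP[/orP[]|]|].
- rewrite !inE -orbA => /or3P[] /eqP ->.
  + have -> : [set 0] = axis [set 0] :> {set V}.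
      apply/setP => -[[x y] z]; rewrite !inE /= -[X in _ == X]/((0, 0), 0) !xpair_eqE.
      by rewrite andbA.
    by apply: chi_axis_factor => //; rewrite !inE eqxx ?orbT.
  + by apply: (chi_axis_factor (T := perp :\ 0)) => //; rewrite !inE eqxx ?orbT.
  + have -> : cellB2 k Vn K0 = axis (~: perp).
      by apply/setP => v; rewrite [LHS]inE [RHS]inE in_setC.
    by apply: chi_axis_factor => //; rewrite !inE eqxx ?orbT.
- case/imsetP => j jG ->.
  (* An e cell is a level set on z = 0 with the axis removed. Since H' vanishes on the axis, the
     part removed is all of it for [j = 0] and empty otherwise. *)
  have -> : celle (P0' s s' gamma P) j =
      [set v | (v.2 \in [set 0]) && (H' v == j)] :\: axis [set: Fq].
    apply/setP => -[[x y] z]; rewrite !inE /=.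
    case: (eqVneq z 0) => [->|]; last by rewrite !andbF.
    by rewrite Hfun'_P0' /= andbT.
  rewrite !chi_setD; congr (_ - _); first by apply: chi_level_factor => //; rewrite !inE eqxx !orbT.
  have -> : [set v | (v.2 \in [set 0]) && (H' v == j)] :&: axis [set: Fq] =
      if j == 0 then axis [set: Fq] else set0.
    apply/setP => -[[x y] z]; rewrite [j == 0]eq_sym.
    case: ifP => j0; rewrite !inE /=; case: (eqVneq z 0) => [->|]; rewrite ?andbF //;
      case: (eqVneq x 0) => [->|]; rewrite ?andbF //=;
      by rewrite Hfun'_P0' P0'0 // j0.
  case: ifP => _; last by rewrite /Defs.chi !big_set0.
  by apply: chi_axis_factor => //; rewrite !inE eqxx.
- case/imsetP => j jG ->.
  by apply: (chi_level_factor (S := K0 :\ 0)) => //; rewrite !inE eqxx orbT.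
- case/imsetP => j jG ->.
  have -> : cellc K0 H' j = [set v | (v.2 \in ~: K0) && (H' v == j)].
    by apply/setP => v; rewrite !inE.
  by apply: chi_level_factor => //; rewrite !inE eqxx.
Qed.

End Factor.
End MainForm.

(** * Numbers of cells *)

(** Here [a] stands for K_0 = {0}, [b] for K_0 = F_q, and [c] for the value 0 being missed on the e
    part. The summands count {0}, B_1, B_2 and the e, d, c cells; the successor on the right
    accounts for the diagonal relation. *)
Lemma class_count_arith (a b c : bool) (q : nat) : (0 < q)%N -> ~~ (a && b) ->
  (1 + ~~ b + ~~ a + (q - c) + ~~ a * q + ~~ b * q)%N =
  (if a || b then 2 * q + (if c then 0 else 1) else 3 * q + 1 + (if c then 0 else 1)).+1.
Proof. by move=> q0; case: a; case: b; case: c => //= _; lia. Qed.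

Section LabelCount.
Variables (R : realType) (p k : nat) (Fq : finFieldType) (Vn : vectType 'F_p).
Hypotheses (p_pr : prime p) (p_odd : odd p) (cardF : #|Fq| = (p ^ k)%N).
Local Notation ze := (zexp R (p := p)).
Local Notation vn := (finvect_type Vn).
Local Notation V := (vn * Fq * Fq)%type.
Local Notation n := (\dim {:Vn}).
Variables (s s' : nat) (Q : Fq -> vn -> Fq) (e : Fq -> int) (gamma : Fq).
Hypotheses (sk : (s %| k)%N) (s's : (s' %| s)%N) (n_even : ~~ odd n) (s_le : (s <= n./2)%N).
Hypotheses (Q_GF : forall z x, Q z x \in GF p Fq s) (Q00 : Q 0 0 = 0)
  (gammaG : gamma \in GFstar p Fq s).
Hypothesis e_sign : {in GFstar p Fq s, forall t, e t = 1 \/ e t = -1}.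
Hypothesis Q_sum : {in GFstar p Fq s, forall t,
  \sum_x ze (TrFp p s (t * Q 0 x)) = (e t)%:~R * bent_norm R Vn}.
Local Notation H' := (Hfun' (p := p) k s s' gamma Q).
Local Notation Q0' := (P0' (p := p) s s' gamma Q).

Import Order.TTheory Num.Theory.

Let s_gt0 : (0 < s)%N. Proof. exact: dvdn_gt0 (k_gt0 cardF) sk. Qed.
Let s'_gt0 : (0 < s')%N. Proof. exact: dvdn_gt0 s_gt0 s's. Qed.
Let s'k : (s' %| k)%N. Proof. exact: dvdn_trans s's sk. Qed.
Let gG : gamma \in GF p Fq s. Proof. by case/GFstarP: gammaG. Qed.
Let g0 : gamma != 0. Proof. by case/GFstarP: gammaG. Qed.

Definition fibre_count j := #|[set x : vn | Q0' x == j]|.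

Let N := (p ^ n./2)%N.

Let card_vnN : #|vn| = (N * N)%N.
Proof. by rewrite card_vn // -expnD addnn even_halfK. Qed.

Let N_gt0 : (0 < N)%N. Proof. by rewrite expn_gt0 prime_gt0. Qed.

Let s'_le : (p ^ s' <= N)%N.
Proof.
by rewrite leq_exp2l ?prime_gt1 // (leq_trans _ s_le) // dvdn_leq.
Qed.

Let scaleG u : u \in GFstar p Fq s' -> u * gamma \in GFstar p Fq s.
Proof. by move=> uG; rewrite GFstarM // (GFstar_dvd s's). Qed.

Lemma card_GFstar m : (m %| k)%N -> (0 < m)%N -> #|GFstar p Fq m| = (p ^ m).-1.
Proof.
move=> mk m0; have := cardsD1 0 (GF p Fq m).
by rewrite (GF0 Fq p_pr) (card_GF p_pr cardF) // => ->.
Qed.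

(** The fibre is counted by orthogonality: u = 0 contributes all N^2 points, and every other u
    contributes N times a sign and a root of unity. *)
Lemma fibre_countE j : j \in GF p Fq s' ->
  (p ^ s')%:R * (fibre_count j)%:R = N%:R * (N%:R +
    \sum_(u in GFstar p Fq s') (e (u * gamma))%:~R * ze (TrFp p s' (u * - j))) :> R[i].
Proof.
move=> jG; have Q0'G x : Q0' x \in GF p Fq s' by rewrite (Tr_GF p_pr cardF) ?GFM.
transitivity (\sum_x \sum_(u in GF p Fq s') ze (TrFp p s' (u * (Q0' x - j)))).
  under eq_bigr => x _ do
    rewrite (sum_TrFp R p_pr p_odd cardF) ?(GFB p_pr cardF) // subr_eq0.
  rewrite -mulr_sumr /fibre_count -sum1_card natr_sum big_mkcond; congr (_ * _).
  by apply: eq_bigr => x _; rewrite inE; case: (_ == j).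
rewrite exchange_big (big_setD1 0) ?GF0 //= mulrDr; congr (_ + _).
  under eq_bigr => x _ do rewrite mul0r (TrFp0 p_pr cardF) zexp0.
  by rewrite sumr_const card_vnN natrM.
rewrite mulr_sumr; apply: eq_bigr => u uG; have [uG' _] := GFstarP _ _ _ uG.
rewrite mulrA [N%:R * _]mulrC -(Q_sum (scaleG uG)) mulr_suml; apply: eq_bigr => x _.
rewrite mulrBr (TrFpD p_pr cardF) ?GFM ?(GFN p_pr cardF) ?GFM // zexpD // -mulrN.
by rewrite /P0' -TrZ // (TrFp_trans p_pr cardF) // mulrA.
Qed.

Let norm_e u : u \in GFstar p Fq s' -> `|(e (u * gamma))%:~R : R[i]| = 1.
Proof. by move=> /scaleG/e_sign[] ->; rewrite ?normr1 // normrN1. Qed.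

(** An empty fibre would make N the absolute value of a sum of p^s' - 1 numbers of modulus 1,
    contrary to p^s' <= N. *)
Lemma fibre_count_gt0 j : j \in GF p Fq s' -> (0 < fibre_count j)%N.
Proof.
move=> jG; rewrite lt0n; apply/eqP => c0; have := fibre_countE jG.
rewrite c0 mulr0 => /esym/eqP; rewrite mulf_eq0 pnatr_eq0 gtn_eqF //=.
rewrite addrC addr_eq0 => /eqP/(congr1 Num.norm); rewrite normrN normr_nat.
move=> NE; have : (N%:R : R[i]) <= \sum_(u in GFstar p Fq s') 1.
  rewrite -NE (le_trans (ler_norm_sum _ _ _)) // ler_sum // => u uG.
  by rewrite normrM norm_e // norm_zexp // mul1r.
rewrite sumr_const ler_nat card_GFstar // leqNgt -ltnS prednK ?expn_gt0 ?prime_gt0 //.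
by rewrite ltnS s'_le.
Qed.

Lemma fibre_count0E : ((p ^ s')%:Z * (fibre_count 0)%:Z =
  N%:Z * (N%:Z + \sum_(u in GFstar p Fq s') e (u * gamma)))%R.
Proof.
apply: (@intr_inj R[i]); rewrite !rmorphM rmorphD rmorph_sum /=.
apply: etrans (fibre_countE (GF0 Fq p_pr s')) _; congr (_ * (_ + _)).
by apply: eq_bigr => u _; rewrite oppr0 mulr0 (TrFp0 p_pr cardF) zexp0 mulr1.
Qed.

(** The integer factor [M + T] must be positive, and if it were at least 2 the product would exceed
    [q], as q <= M. *)
Let sum_int_eq (q M : nat) (T : int) : (0 < q)%N -> (q <= M)%N ->
  q%:Z = M%:Z * (M%:Z + T) -> M = q /\ T = 1 - q%:Z.
Proof.
move=> q0 qM; set m := _ + T => E; suff m1 : m = 1 by split; move: E m1; rewrite /m; nia.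
have [|[//|]] : m <= 0 \/ m = 1 \/ 2 <= m by lia.
- by move=> m0; exfalso; nia.
- by move=> m2; exfalso; nia.
Qed.

(** This isolates the exceptional case delta' = 0. A fibre of size 1 forces N = p^s', hence s' = s =
    n / 2, and makes the p^s' - 1 signs add up to 1 - p^s', so all are -1. *)
Lemma fibre_count0_eq1 : (fibre_count 0%R == 1)%N =
  [&& s' == s, n == (2 * s)%N & [forall t in GFstar p Fq s, e t == -1]].
Proof.
have ps_gt0 : (0 < p ^ s')%N by rewrite expn_gt0 prime_gt0.
have card_star : #|GFstar p Fq s'|%:Z = (p ^ s')%:Z - 1.
  by rewrite card_GFstar //; move: ps_gt0; lia.
have n2 : n = (2 * n./2)%N by rewrite mul2n even_halfK.
have := fibre_count0E; set S := \sum_(u in _) _ => E.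
apply/eqP/and3P => [c1|[/eqP s's_eq /eqP n2s /forall_inP eN]].
  move: E; rewrite c1 mulr1 => /(sum_int_eq ps_gt0 s'_le)[/(expnI (prime_gt1 p_pr)) ns' SE].
  have ss' : s' = s by apply/eqP; rewrite eqn_leq dvdn_leq //= -ns'.
  split; [by rewrite ss' | by rewrite {1}n2 ns' ss' |].
  (* Each term [e + 1] is nonnegative and their sum is 0. *)
  have e1 : forall u, u \in GFstar p Fq s' -> e (u * gamma) + 1 = 0.
    apply: psumr_eq0P => [u /scaleG/e_sign[] -> //|].
    rewrite big_split /= -/S SE sumr_const -[1 *+ _]/(#|GFstar p Fq s'|%:R) natz card_star.
    ring.
  apply/forall_inP => t tG; rewrite -(divfK g0 t) -addr_eq0 e1 //.
  by rewrite ss' GFstarM // GFstarV.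
have NE : N = (p ^ s')%N by rewrite /N n2s s's_eq mul2n doubleK.
have SE : S = 1 - (p ^ s')%:Z.
  rewrite /S (eq_bigr (fun _ => -1)) => [|u /scaleG/eN/eqP //].
  rewrite sumr_const mulNrn -[1 *+ _]/(#|GFstar p Fq s'|%:R) natz card_star.
  ring.
move: E; rewrite NE SE; move: ps_gt0; nia.
Qed.

(** All fibres are nonempty, so nonzero values are attained away from 0; the value 0 is attained
    there exactly when its fibre has a second point. *)
Lemma image_P0' : Q0' @: [set x | x != 0] =
  if (fibre_count 0%R == 1)%N then GFstar p Fq s' else GF p Fq s'.
Proof.
have Q0'0 : Q0' 0 = 0 by exact: P0'0.
have Q0'G x : Q0' x \in GF p Fq s' by rewrite (Tr_GF p_pr cardF) ?GFM.
apply/setP => j; apply/imsetP/idP => [[x + ->]|].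
  rewrite inE => x0; case: ifPn => // c1; apply/GFstarP; split=> //.
  apply: contraTneq c1 => Qx; rewrite neq_ltn; apply/orP; right.
  rewrite /fibre_count (cardD1 0) inE Q0'0 eqxx ltnS.
  by apply/card_gt0P; exists x; rewrite !inE x0 Qx eqxx.
move=> jG; have [j0|j0] := eqVneq j 0; last first.
  have : (0 < fibre_count j)%N.
    by apply: fibre_count_gt0; move: jG; case: ifP => // _ /GFstarP[].
  case/card_gt0P => x; rewrite inE => /eqP Qx; exists x => //; rewrite inE.
  by apply: contraNneq j0 => x0; rewrite -Qx x0 Q0'0.
move: jG; rewrite j0; case: ifPn => [_ /GFstarP[_ /eqP]//|c1 _].
have : (1 < fibre_count 0%R)%N.
  by rewrite ltn_neqAle eq_sym c1 fibre_count_gt0 ?GF0.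
rewrite /fibre_count (cardD1 0) inE Q0'0 eqxx ltnS => /card_gt0P[x].
by rewrite !inE => /andP[x0 /eqP Qx]; exists x; rewrite ?inE.
Qed.

(** For z nonzero the summand Tr(y z) alone takes all values, even at x = 0. *)
Lemma Hfun_onto z h : z != 0 -> h \in GF p Fq s ->
  exists y, Hfun (p := p) k s Q (0, y, z) = h.
Proof.
move=> z0 hG; have hQ : h - Q z 0 \in GF p Fq s by rewrite (GFB p_pr cardF).
have [w _ wE] := Tr_surj p_pr cardF (dvdnn k) sk (k_gt0 cardF) hQ.
by exists (w / z); rewrite /Hfun /= divfK // wE addrC subrK.
Qed.

Lemma Hfun'_onto z j : z != 0 -> j \in GF p Fq s' ->
  exists y, H' (0, y, z) = j.
Proof.
move=> z0 jG; have [h hG <-] := Tr_surj p_pr cardF sk s's s_gt0 jG.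
have hgG : h / gamma \in GF p Fq s by rewrite GFM ?GFV.
have [y yE] := Hfun_onto z0 hgG.
by exists y; rewrite /Hfun' yE mulrCA divff // mulr1.
Qed.

Variable K0 : {set Fq}.
Hypothesis K0sub : GFsubspace p s K0.

Let K00 : 0 \in K0. Proof. exact: subspace0 K0sub. Qed.
Let perp_0 : 0 \in perp p k K0. Proof. exact: (perp0 p_pr cardF). Qed.
Let H'_GF v : H' v \in GF p Fq s'. Proof. exact: Hfun'_GF. Qed.
Let H'0 y : H' (0, y, 0) = 0. Proof. by rewrite Hfun'_P0' // P0'0. Qed.

Definition class_count (delta : nat) :=
  if (K0 == [set 0]) || (K0 == [set: Fq])
  then (2 * p ^ s' + delta)%N else (3 * p ^ s' + 1 + delta)%N.

Lemma image_tag_full (t : 'I_6) z : z != 0 ->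
  (forall v : V, v.2 = z -> tag k K0 v = t) ->
  H' @: [set v : V | tag k K0 v == t] = GF p Fq s'.
Proof.
move=> z0 zt; apply/setP => j; apply/imsetP/idP => [[v _ ->] //|jG].
by have [y yE] := Hfun'_onto z0 jG; exists (0, y, z); rewrite ?inE ?zt.
Qed.

Lemma image_tag_axis (t : 'I_6) :
  (forall v : V, tag k K0 v = t -> v.1.1 = 0 /\ v.2 = 0) ->
  #|H' @: [set v : V | tag k K0 v == t]| =
    [exists y, tag k K0 ((0 : vn), y, 0) == t].
Proof.
move=> tv; case: (boolP [exists y, _]) => [/existsP[y ty]|no].
  rewrite [_ @: _](_ : _ = [set 0]) ?cards1 //; apply/setP => j; rewrite in_set1.
  apply/imsetP/eqP => [[[[x y'] z]] | ->].
    by rewrite inE => /eqP/tv[/= -> ->] ->; rewrite H'0.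
  by exists (0, y, 0); rewrite ?inE ?H'0.
rewrite [_ @: _](_ : _ = set0) ?cards0 //; apply/setP => j; rewrite in_set0.
apply/imsetP => -[[[x y] z]]; rewrite inE => /[dup] /eqP/tv[/= -> ->] ty _.
by move: no; rewrite negb_exists => /forallP/(_ y); rewrite ty.
Qed.

(** The values are counted part by part. The family and its signs are abstract, so that the count
    applies to P with the signs [eps 0 t] and to G with the signs [eps 0 t^-1]. *)
Lemma card_image_label : #|label k K0 H' @: [set: V]| =
  (class_count (if [&& s' == s, n == (2 * s)%N & [forall t in GFstar p Fq s, (e t == -1)%R]]
                then 0%N else 1%N)).+1.
Proof.
have ps_gt0 : (0 < p ^ s')%N by rewrite expn_gt0 prime_gt0.
have sum6 (F : 'I_6 -> nat) : (\sum_(t < 6) F t =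
    F 'tag_0 + F 'tag_1 + F 'tag_2 + F 'tag_3 + F 'tag_4 + F 'tag_5)%N.
  rewrite !big_ord_recr big_ord0 /= add0n.
  by do !congr (_ + _)%N; congr F; apply: val_inj.
have c0 : #|H' @: [set v : V | tag k K0 v == 'tag_0]| = 1%N.
  rewrite image_tag_axis => [|v /eqP]; last by rewrite (tag0E K00 perp_0) => /eqP ->.
  by rewrite (introT existsP) //; exists 0; rewrite (tag0E K00 perp_0); exact: eqxx.
(* B_1 is nonempty exactly when [perp] is not {0}, that is, when [K0] is not the whole field;
   dually, B_2 is nonempty exactly when [K0] is not {0}. *)
have c1 : #|H' @: [set v : V | tag k K0 v == 'tag_1]| = (K0 != [set: Fq]) :> nat.
  rewrite image_tag_axis => [|v /eqP]; last first.
    by rewrite (tag1E k K00) => /and3P[/eqP -> _ /eqP ->].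
  rewrite -(perp_trivial R p_pr p_odd cardF K0sub); congr (nat_of_bool _).
  rewrite eq_sym eqEcard sub1set perp_0 cards1 /= -ltnNge (cardsD1 0) perp_0 ltnS.
  apply/existsP/card_gt0P => -[y yP]; exists y.
    by move: yP; rewrite (tag1E k K00) => /and3P[].
  by rewrite (tag1E k K00) /= eqxx yP eqxx.
have c2 : #|H' @: [set v : V | tag k K0 v == 'tag_2]| = (K0 != [set 0]) :> nat.
  rewrite image_tag_axis => [|v /eqP]; last first.
    by rewrite (tag2E k K00) => /and3P[/eqP -> _ /eqP ->].
  rewrite -(perp_full R p_pr p_odd cardF K0sub); congr (nat_of_bool _).
  rewrite -subTset; apply/existsP/subsetPn => -[y]; last first.
    by move=> _ yP; exists y; rewrite (tag2E k K00) /= eqxx yP eqxx.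
  by rewrite (tag2E k K00) => /and3P[_ yP _]; exists y; rewrite ?in_setT.
have c3 : #|H' @: [set v : V | tag k K0 v == 'tag_3]| =
    (p ^ s' - (fibre_count 0%R == 1))%N.
  have -> : H' @: [set v : V | tag k K0 v == 'tag_3] = Q0' @: [set x | x != 0].
    apply/setP => j; apply/imsetP/imsetP => [[[[x y] z]]|[x]].
      rewrite inE (tag3E k K00) /= => /andP[/eqP -> x0] ->.
      by exists x; rewrite ?inE // Hfun'_P0'.
    rewrite inE => x0 ->; exists (x, 0, 0); last by rewrite Hfun'_P0'.
    by rewrite inE (tag3E k K00) /= eqxx.
  rewrite image_P0'; case: ifP => _; first by rewrite card_GFstar // subn1.
  by rewrite (card_GF p_pr cardF) // subn0.
have c4 : #|H' @: [set v : V | tag k K0 v == 'tag_4]| =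
    ((K0 != [set 0%R]) * p ^ s')%N.
  have [K0E|] := eqVneq K0 [set 0].
    rewrite (_ : [set v | _] = set0) ?imset0 ?cards0 //; apply/setP => v.
    by rewrite inE tag4E K0E setDv !in_set0.
  rewrite eq_sym eqEcard sub1set K00 cards1 /= -ltnNge (cardsD1 0) K00 ltnS mul1n.
  case/card_gt0P => z zK; have /andP[z0 _] : (z != 0) && (z \in K0).
    by rewrite -in_setD1.
  rewrite (image_tag_full (t := 'tag_4) z0) ?(card_GF p_pr cardF) // => v vz.
  by apply/eqP; rewrite tag4E vz.
have c5 : #|H' @: [set v : V | tag k K0 v == 'tag_5]| =
    ((K0 != [set: Fq]) * p ^ s')%N.
  have [K0E|] := eqVneq K0 [set: Fq].
    rewrite (_ : [set v | _] = set0) ?imset0 ?cards0 //; apply/setP => v.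
    by rewrite inE tag5E K0E !inE.
  rewrite -subTset => /subsetPn[z _ zK]; rewrite mul1n.
  have z0 : z != 0 by apply: contraNneq zK => ->.
  rewrite (image_tag_full (t := 'tag_5) z0) ?(card_GF p_pr cardF) // => v vz.
  by apply/eqP; rewrite tag5E vz.
rewrite card_label_image sum6 c0 c1 c2 c3 c4 c5 -fibre_count0_eq1 /class_count.
have K0_proper : ~~ ((K0 == [set 0]) && (K0 == [set: Fq])).
  apply/negP => /andP[/eqP -> /eqP/setP/(_ 1)].
  by rewrite !inE oner_eq0.
exact: class_count_arith.
Qed.

End LabelCount.

(** * Fusions *)

Section Fusions.
Variables (T : finType).

(** A level set of [f] is the union of the level sets of [g] contained in it. *)
Lemma preim_fusion (T1 T2 : eqType) (f : T -> T1) (g : T -> T2) :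
  (forall x y, g x = g y -> f x = f y) ->
  fusion (preim_partition f [set: T]) (preim_partition g [set: T]).
Proof.
move=> fg _ /imsetP[x _ ->]; set S := [set _ in _ | _].
exists [set U in preim_partition g [set: T] | U \subset S].
  by apply/subsetP => U; rewrite inE => /andP[].
apply/setP => y; apply/idP/bigcupP => [yS|[U]]; last first.
  by rewrite inE => /andP[_ /subsetP US] /US.
exists [set w in [set: T] | g y == g w]; last by rewrite !inE eqxx.
rewrite inE imset_f ?inE //=; apply/subsetP => w; rewrite !inE /= => /eqP/fg <-.
by move: yS; rewrite !inE.
Qed.

Lemma preim_partition_eq (T1 T2 : eqType) (f : T -> T1) (g : T -> T2) x y :
  preim_partition f [set: T] = preim_partition g [set: T] -> f x = f y -> g x = g y.
Proof.
move=> fg fxy; have : [set w in [set: T] | f x == f w] \in preim_partition g [set: T].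
  by rewrite -fg imset_f ?inE.
case/imsetP => w _ /setP E; have := E x; have := E y.
by rewrite !inE /= fxy eqxx => /esym/eqP <- /esym/eqP <-.
Qed.

End Fusions.

Lemma relations_fusion (V : finZmodType) (A B : {set {set V}}) :
  fusion A B -> fusion (relations A) (relations B).
Proof.
move=> AB _ /imsetP[U UA ->]; have [C CB ->] := AB U UA.
exists (relations C); first exact: imsetS.
rewrite /relations cover_imset; apply/setP => u; rewrite inE.
by apply/bigcupP/bigcupP => -[W WC uW]; exists W => //; move: uW; rewrite inE.
Qed.

Lemma relations_inj (V : finZmodType) : injective (@relations V).
Proof.
apply: imset_inj => A B /setP AB; apply/setP => x.
by have := AB (0, x); rewrite !inE /= subr0.
Qed.

(** * Scaled traces with the same kernel *)

Section TraceKernel.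
Variables (p k s s' : nat) (Fq : finFieldType).
Hypotheses (p_pr : prime p) (cardF : #|Fq| = (p ^ k)%N).
Hypotheses (sk : (s %| k)%N) (s's : (s' %| s)%N).
Local Notation GF := (GF p Fq).
Local Notation Trs := (Tr p s s').

Let s_gt0 : (0 < s)%N. Proof. exact: dvdn_gt0 (k_gt0 cardF) sk. Qed.

Lemma Tr_dual_unit g : g \in GFstar p Fq s ->
  exists2 h, h \in GF s & Trs (g * h) = 1.
Proof.
case/GFstarP => gG g0.
have [x xG x1] := Tr_surj p_pr cardF sk s's s_gt0 (GF1 p Fq s').
by exists (x / g); rewrite ?GFM ?GFV // mulrCA divff // mulr1.
Qed.

(** Choose [h1] with Tr(g1 h1) = 1. Then h - Tr(g1 h) h1 is in the first kernel, so Tr(g2 h) = l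
    Tr(g1 h) for all h, with l = Tr(g2 h1); nondegeneracy of the trace gives g2 = l g1. *)
Lemma Tr_kernel_sub g1 g2 : g1 \in GFstar p Fq s -> g2 \in GFstar p Fq s ->
  {in GF s, forall h, Trs (g1 * h) = 0 -> Trs (g2 * h) = 0} ->
  g1 / g2 \in GFstar p Fq s'.
Proof.
move=> /[dup] g1G /GFstarP[g1s g10] /[dup] g2G /GFstarP[g2s g20] ker.
have [h1 h1G h1E] := Tr_dual_unit g1G.
pose l := Trs (g2 * h1); have lG : l \in GF s' by rewrite (Tr_GF p_pr cardF) ?GFM.
have lG' := GF_dvd s's lG.
have Tr_l h : h \in GF s -> Trs (g2 * h) = l * Trs (g1 * h).
  move=> hG; have cG : Trs (g1 * h) \in GF s' by rewrite (Tr_GF p_pr cardF) ?GFM.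
  have cG' := GF_dvd s's cG.
  have := ker (h - Trs (g1 * h) * h1); rewrite (GFB p_pr cardF) ?GFM // => /(_ isT).
  rewrite !mulrBr !(TrB p_pr cardF) ![_ * (Trs _ * _)]mulrCA !(TrZ _ _ cG) h1E mulr1 subrr.
  by move=> /(_ erefl)/eqP; rewrite subr_eq0 => /eqP ->; rewrite mulrC.
have g2E : g2 = l * g1.
  apply/eqP; rewrite -subr_eq0; apply/negPn/negP => d0.
  have dG : g2 - l * g1 \in GFstar p Fq s.
    by apply/GFstarP; rewrite (GFB p_pr cardF) ?GFM.
  have [h hG /eqP] := Tr_dual_unit dG.
  rewrite mulrBl (TrB p_pr cardF) -mulrA (TrZ _ _ lG) -Tr_l // subrr eq_sym.
  by rewrite oner_eq0.
have l0 : l != 0 by apply: contraNneq g20 => l0; rewrite g2E l0 mul0r.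
by rewrite g2E invfM mulrCA divff // mulr1; apply/GFstarP; rewrite GFV ?invr_eq0.
Qed.

End TraceKernel.

Lemma eq_Omega (p k : nat) (Vn : vectType 'F_p) (Fq : finFieldType) (K0 : {set Fq})
    (m : nat) (H1 H2 : finvect_type Vn * Fq * Fq -> Fq) (P1 P2 : finvect_type Vn -> Fq) :
  H1 =1 H2 -> P1 =1 P2 -> Omega k K0 m H1 P1 = Omega k K0 m H2 P2.
Proof.
move=> H12 P12; rewrite /Omega; congr ((_ :|: _ :|: _ :|: _) :\ _); apply: eq_imset => i;
  by apply/setP => v; rewrite !inE ?H12 ?P12.
Qed.

(* Stated for abstract factors: for concrete ones the unifier is slow to identify
   the finType structure of a product with that of the product zmodType. *)
Section ProductScheme.
Variables (T1 T2 : finZmodType).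
Local Notation V := (T1 * T2)%type.

Lemma product_reflexive (R : realType) (p : nat) (T : finType)
    (form : V -> V -> 'F_p) (O : {set {set V}}) (L : V -> T) :
  prime p -> odd p ->
  (forall z, {morph form^~ z : x y / x + y}) -> (forall z, {morph form z : x y / x + y}) ->
  (forall x, x != 0 -> exists xi, form xi x != 0) ->
  partition O [set: V] -> [set 0] \in O ->
  {in O, forall U xi eta, L xi = L eta -> chi R form xi U = chi R form eta U} ->
  (#|L @: [set: V]| <= #|O|)%N -> Fourier_reflexive R form O.
Proof.
move=> p_pr p_odd formDl formDr sep partO O0 chiL LO.
by split=> //; exact: (card_dual_factor p_pr p_odd formDl formDr sep partO chiL LO).
Qed.

Lemma product_scheme (R : realType) (p : nat) (form : V -> V -> 'F_p) (O : {set {set V}})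
    (d : nat) : prime p -> odd p ->
  (forall z, {morph form^~ z : x y / x + y}) -> (forall z, {morph form z : x y / x + y}) ->
  (forall x, x != 0 -> exists xi, form xi x != 0) ->
  Fourier_reflexive R form O -> #|O| = d.+1 -> association_scheme d (relations O).
Proof.
move=> p_pr p_odd formDl formDr sep refO cO.
exact: (Fourier_reflexive_scheme p_pr p_odd formDl formDr sep refO cO).
Qed.

Lemma product_relations_fusion (A B : {set {set V}}) :
  fusion A B -> fusion (relations A) (relations B).
Proof. exact: relations_fusion. Qed.

Lemma card_product_relations (I : finType) (D : {set I}) (F : I -> {set {set V}}) :
  #|[set relations (F i) | i in D]| = #|[set F i | i in D]|.
Proof. by rewrite (imset_comp _ F) card_imset //; exact: relations_inj. Qed.

End ProductScheme.

(** * Application to the families P and G *)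

Section Assembly.
Variables (R : realType) (p k s : nat) (Fq : finFieldType) (Vn : vectType 'F_p).
Variables (form : {symmetric finvect_type Vn}) (K0 : {set Fq}).
Variables (P G : Fq -> finvect_type Vn -> Fq) (eps : Fq -> Fq -> int).
Local Notation vn := (finvect_type Vn).
Local Notation V := (vn * Fq * Fq)%type.
Local Notation n := (\dim {:Vn}).
Local Notation ze := (zexp R (p := p)).
Hypotheses (p_pr : prime p) (p_odd : odd p) (cardF : #|Fq| = (p ^ k)%N)
  (sk : (s %| k)%N) (n_even : ~~ odd n) (s_le : (s <= n./2)%N)
  (form_nd : nondegenerate form) (K0sub : GFsubspace p s K0)
  (P_GF : forall z x, P z x \in GF p Fq s) (G_GF : forall z x, G z x \in GF p Fq s)
  (P_scale : forall z c, c \in GFstar p Fq s -> P (c * z) =1 P z)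
  (P_sign : forall z, sign_pattern R form s (P z) (eps z))
  (P_inv : forall z, inversion_type R form s (P z) (G z))
  (epsK1 : {in ~: K0 &, forall z1 z2, {in GFstar p Fq s, eps z1 =1 eps z2}})
  (epsK0 : {in K0 :\ 0 &, forall z1 z2, {in GFstar p Fq s, eps z1 =1 eps z2}})
  (P00 : P 0 0 = 0) (G00 : G 0 0 = 0).

Import Num.Theory.

Let s_gt0 : (0 < s)%N. Proof. exact: dvdn_gt0 (k_gt0 cardF) sk. Qed.
Let K00 : 0 \in K0. Proof. exact: subspace0 K0sub. Qed.
Let perp_0 : 0 \in perp p k K0. Proof. exact: (perp0 p_pr cardF). Qed.

Lemma bent_norm_neq0 : bent_norm R Vn != 0.
Proof. by rewrite pnatr_eq0 -lt0n expn_gt0 prime_gt0. Qed.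

Lemma bent_norm_sqr : bent_norm R Vn * bent_norm R Vn = #|vn|%:R.
Proof. by rewrite -natrM -expnD addnn even_halfK // card_vn. Qed.

Lemma eps_sign z t : t \in GFstar p Fq s -> eps z t = 1 \/ eps z t = -1.
Proof. by case/(P_sign z) => _ [fs /(_ 0)[]]. Qed.

(** The sign pattern provides the sign with some dual, inversion type the dual with some sign;
    uniqueness of both in [sign_zexp_inj] merges the two. *)
Lemma component_Walsh z t b : t \in GFstar p Fq s ->
  Walsh R form (component s (P z) t) b =
  (eps z t)%:~R * bent_norm R Vn * ze (TrFp p s (t^-1 * G z b)).
Proof.
move=> tG; have [_ [fs /(_ b)[e1 W1]]] := P_sign z tG.
have [eps' /(_ b)[e2 W2]] := P_inv z tG.
have := W1; rewrite W2 ![_ * bent_norm _ _]mulrC -!mulrA => /(mulfI bent_norm_neq0).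
by move=> /(sign_zexp_inj p_pr p_odd e2 e1)[-> _]; rewrite mulrCA mulrA.
Qed.

Lemma sum_P0 t : t \in GFstar p Fq s ->
  \sum_x ze (TrFp p s (t * P 0 x)) = (eps 0 t)%:~R * bent_norm R Vn.
Proof.
move=> tG; have := component_Walsh 0 0 tG.
rewrite G00 mulr0 (TrFp0 p_pr cardF) zexp0 mulr1 => <-; apply: eq_bigr => x _.
by rewrite linear0l subr0.
Qed.

(* Inverting the Walsh transform of P^(0)_t at 0. *)
Lemma sum_G0 t : t \in GFstar p Fq s ->
  \sum_x ze (TrFp p s (t * G 0 x)) = (eps 0 t^-1)%:~R * bent_norm R Vn.
Proof.
move=> tG; have tVG := GFstarV tG; have e1 := eps_sign 0 tVG.
have e_sqr : (eps 0 t^-1)%:~R * (eps 0 t^-1)%:~R = 1 :> R[i].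
  by case: e1 => ->; rewrite ?mulr1 // mulrN1 opprK.
have e_neq0 : (eps 0 t^-1)%:~R != 0 :> R[i] by rewrite intr_eq0; case: e1 => ->.
apply: (mulfI (mulf_neq0 e_neq0 bent_norm_neq0)).
rewrite mulrACA e_sqr mul1r bent_norm_sqr.
transitivity (\sum_b Walsh R form (component s (P 0) t^-1) b).
  rewrite mulr_sumr; apply: eq_bigr => b _.
  by rewrite component_Walsh // invrK.
rewrite exchange_big (bigD1 0) //= [X in _ + X]big1 => [|x x0].
  under eq_bigr => b _ do
    rewrite linear0r subr0 /component P00 mulr0 (TrFp0 p_pr cardF) zexp0.
  by rewrite addr0 sumr_const.
under eq_bigr => b _ do rewrite zexpD // form_sym.
by rewrite -mulr_sumr sum_form // (negPf x0) !mulr0.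
Qed.

Section Level.
Variables (s' : nat) (gamma : Fq).
Hypotheses (s's : (s' %| s)%N) (gammaG : gamma \in GFstar p Fq s).
Local Notation H := (Hfun (p := p) k s P).
Local Notation H' := (Hfun' (p := p) k s s' gamma P).
Local Notation Om' := (OmegaH' (p := p) k K0 s s' gamma P).

Let gG : gamma \in GF p Fq s. Proof. by case/GFstarP: gammaG. Qed.

Lemma OmegaH'E : Om' = preim_partition (label k K0 H') [set: V].
Proof.
apply: OmegaE => // [v|x y|]; first exact: Hfun'_GF.
  exact: Hfun'_P0'.
exact: P0'0.
Qed.

Lemma partition_OmegaH' : partition Om' [set: V].
Proof. by rewrite OmegaH'E preim_partitionP. Qed.

Definition scheme_delta : nat :=
  if [&& s' == s, n == (2 * s)%N & [forall t in GFstar p Fq s, eps 0 t == -1]]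
  then 0%N else 1%N.

Lemma card_OmegaH' : #|Om'| = (class_count p s' K0 scheme_delta).+1.
Proof.
rewrite OmegaH'E card_preim_partition.
exact: (card_image_label p_pr p_odd cardF sk s's n_even s_le P_GF P00 gammaG
  (@eps_sign 0) sum_P0 K0sub).
Qed.

(** The map [dual_point] is a bijection, so the labels of G with multiplier 1 / gamma are counted.
    The signs become [eps 0 t^-1], and the condition that all are -1 is invariant under inverting t,
    so the count is that of the cells. *)
Lemma card_dual_label :
  #|dual_label k s G K0 s' gamma @: [set: V]| = (class_count p s' K0 scheme_delta).+1.
Proof.
have -> : dual_label k s G K0 s' gamma @: [set: V] =
    label k K0 (Hfun' k s s' gamma^-1 G) @: [set: V].
  apply/setP => l; apply/imsetP/imsetP => -[v _ ->].
    by exists (dual_point v).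
  exists (v.1.1, v.2, - v.1.2); rewrite ?inE //.
  by rewrite /dual_label /dual_point /= opprK; case: (v) => [[x y] z].
have eV_sign : {in GFstar p Fq s, forall t, eps 0 t^-1 = 1 \/ eps 0 t^-1 = -1}.
  by move=> t /GFstarV; exact: eps_sign.
rewrite (card_image_label p_pr p_odd cardF sk s's n_even s_le G_GF G00
  (GFstarV gammaG) eV_sign sum_G0 K0sub) /scheme_delta.
have -> : [forall t in GFstar p Fq s, eps 0 t^-1 == -1] =
    [forall t in GFstar p Fq s, eps 0 t == -1].
  apply/forall_inP/forall_inP => E t /GFstarV tG; last exact: E.
  by rewrite -[t]invrK E.
by [].
Qed.

Lemma set0_OmegaH' : [set (0 : V)] \in Om'.
Proof.
rewrite /OmegaH' /Omega in_setD1 !in_setU set11 andbT.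
by apply/set0Pn; exists 0; rewrite set11.
Qed.

Lemma Fourier_reflexive_OmegaH' : Fourier_reflexive R (formV k form) Om'.
Proof.
have LO : (#|dual_label k s G K0 s' gamma @: [set: V]| <= #|Om'|)%N.
  by rewrite card_dual_label card_OmegaH'.
have chiL := chi_factor p_pr p_odd cardF form_nd sk P_GF G_GF P_scale component_Walsh
  K0sub epsK1 epsK0 P00 s's gammaG.
exact: (product_reflexive p_pr p_odd (formVDl form p_pr cardF) (formVDr form p_pr cardF)
  (formV_sep p_pr cardF form_nd) partition_OmegaH' set0_OmegaH' chiL LO).
Qed.

Lemma scheme_OmegaH' :
  association_scheme (class_count p s' K0 scheme_delta) (relations Om').
Proof.
exact: (product_scheme p_pr p_odd (formVDl form p_pr cardF) (formVDr form p_pr cardF)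
  (formV_sep p_pr cardF form_nd) Fourier_reflexive_OmegaH' card_OmegaH').
Qed.

Lemma level_cellE (A : {set V}) j :
  A :&: [set v | H' v == j] =
  \bigcup_(i in GF p Fq s | Tr p s s' (gamma * i) == j) (A :&: [set v | H v == i]).
Proof.
apply/setP => v; rewrite !inE; apply/andP/bigcupP => [[vA vj]|[i /andP[_ ij]]].
  by exists (H v); rewrite ?Hfun_GF // !inE vA eqxx.
by rewrite !inE => /andP[vA /eqP vi]; rewrite vA /Hfun' vi.
Qed.

Lemma cells_fusion j :
  [/\ cellc K0 H' j
        = \bigcup_(i in GF p Fq s | Tr p s s' (gamma * i) == j) cellc K0 H i,
      celld K0 H' j
        = \bigcup_(i in GF p Fq s | Tr p s s' (gamma * i) == j) celld K0 H i &
      celle (P0' s s' gamma P) j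
        = \bigcup_(i in GF p Fq s | Tr p s s' (gamma * i) == j)
            celle (P 0) i :> {set V}].
Proof.
have cE (h : V -> Fq) i : cellc K0 h i = [set v : V | v.2 \notin K0] :&: [set v | h v == i].
  by apply/setP => v; rewrite [LHS]inE [RHS]inE !in_set.
have dE (h : V -> Fq) i : celld K0 h i = [set v : V | v.2 \in K0 :\ 0] :&: [set v | h v == i].
  by apply/setP => v; rewrite [LHS]inE [RHS]inE [in RHS]inE [_ \in [set _ | h _ == _]]inE.
have eE (h : V -> Fq) (f : vn -> Fq) i : (forall x y, h (x, y, 0) = f x) ->
    celle f i = [set v : V | (v.2 == 0) && (v.1.1 != 0)] :&: [set v | h v == i].
  move=> hf; apply/setP => -[[x y] z]; rewrite !inE /=.
  by case: (eqVneq z 0) => [->|//]; rewrite hf.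
have H0 x y : H (x, y, 0) = P 0 x by rewrite /Hfun /= mulr0 (Tr0 Fq p_pr) addr0.
split.
- by rewrite cE level_cellE; apply: eq_bigr => i _; rewrite cE.
- by rewrite dE level_cellE; apply: eq_bigr => i _; rewrite dE.
rewrite (eE H') => [|x y]; last exact: Hfun'_P0'.
by rewrite level_cellE; apply: eq_bigr => i _; rewrite (eE H).
Qed.

End Level.

(** The finest partition is the case s' = s, gamma = 1, so the results for all levels cover it
    too. *)
Lemma OmegaHE : OmegaH (p := p) k K0 s P = OmegaH' k K0 s s 1 P.
Proof.
by apply: eq_Omega => v; rewrite ?/Hfun' ?/P0' mul1r Tr_id.
Qed.

Let one_star : 1 \in GFstar p Fq s.
Proof. by apply/GFstarP; rewrite GF1 oner_neq0. Qed.

Lemma fusion_OmegaH s' gamma : (s' %| s)%N -> gamma \in GFstar p Fq s ->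
  fusion (OmegaH' (p := p) k K0 s s' gamma P) (OmegaH k K0 s P).
Proof.
move=> s's gG; rewrite OmegaHE !OmegaH'E //; apply: preim_fusion => v w [tE hE].
rewrite /label tE; congr (_, _); move: hE.
by rewrite /Hfun' !mul1r !Tr_id // => ->.
Qed.

Lemma fusion_scheme_OmegaH s' gamma : (s' %| s)%N -> gamma \in GFstar p Fq s ->
  fusion_scheme (relations (OmegaH' (p := p) k K0 s s' gamma P))
    (relations (OmegaH k K0 s P)).
Proof.
move=> s's gG; split; last exact/product_relations_fusion/fusion_OmegaH.
  by exists (class_count p s' K0 (scheme_delta s')); exact: scheme_OmegaH'.
by rewrite OmegaHE; exists (class_count p s K0 (scheme_delta s)); exact: scheme_OmegaH'.
Qed.

(* Cells meeting {z = 1} see the kernel of h |-> Tr (gamma * h). *)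
Lemma OmegaH'_inj s' g1 g2 : (s' %| s)%N ->
  g1 \in GFstar p Fq s -> g2 \in GFstar p Fq s ->
  OmegaH' (p := p) k K0 s s' g1 P = OmegaH' (p := p) k K0 s s' g2 P ->
  g1 / g2 \in GFstar p Fq s'.
Proof.
move=> s's g1G g2G; rewrite !OmegaH'E // => OO.
apply: (Tr_kernel_sub p_pr cardF sk s's g1G g2G) => h hG hE.
have [y yE] := Hfun_onto p_pr cardF sk P_GF (oner_neq0 Fq) hG.
have [y0 y0E] := Hfun_onto p_pr cardF sk P_GF (oner_neq0 Fq) (GF0 Fq p_pr s).
have tE (a b : vn * Fq) : tag k K0 (a, 1) = tag k K0 (b, 1).
  by rewrite /tag /= oner_neq0; case: ifP.
have /(preim_partition_eq OO)[_] : label k K0 (Hfun' k s s' g1 P) (0, y, 1) =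
    label k K0 (Hfun' k s s' g1 P) (0, y0, 1).
  by rewrite /label (tE _ (0, y0)) /Hfun' yE y0E hE mulr0 (Tr0 Fq p_pr).
by rewrite /Hfun' yE y0E mulr0 (Tr0 Fq p_pr).
Qed.

(** By [OmegaH'_inj] every fibre of the map from gamma to its partition lies in one coset of
    [GFstar s'], so it has at most p^s' - 1 elements. *)
Lemma card_fusions s' : (s' %| s)%N ->
  ((p ^ s - 1) %/ (p ^ s' - 1) <=
   #|[set relations (OmegaH' (p := p) k K0 s s' gamma P) | gamma in GFstar p Fq s]|)%N.
Proof.
move=> s's; have s'_gt0 := dvdn_gt0 s_gt0 s's; rewrite card_product_relations.
set im := [set _ | _ in _].
have q_gt0 : (0 < p ^ s' - 1)%N.
  by rewrite subn_gt0 -(exp1n s') ltn_exp2r ?prime_gt1.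
suff le : (p ^ s - 1 <= #|im| * (p ^ s' - 1))%N.
  by rewrite (leq_trans (leq_div2r _ le)) // mulnK.
rewrite [in X in (X <= _)%N]subn1 -(card_GFstar p_pr cardF) // -sum1_card.
rewrite (partition_big_imset (fun gamma => OmegaH' (p := p) k K0 s s' gamma P)) /=.
rewrite -sum_nat_const; apply: leq_sum => _ /imsetP[g gG ->].
rewrite subn1 -(card_GFstar p_pr cardF) ?(dvdn_trans s's) // sum1dep_card.
have g0 : g != 0 by case/GFstarP: gG.
rewrite -[X in (_ <= X)%N](card_imset _ (mulIf g0)).
apply: subset_leq_card; apply/subsetP => h; rewrite inE => /andP[hG /eqP].
move=> /(OmegaH'_inj s's hG gG) hgG.
by apply/imsetP; exists (h / g); rewrite // divfK.
Qed.

End Assembly.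

Theorem theorem5p1 (R : realType) (p k s n : nat)
    (Fq : finFieldType) (Vn : vectType 'F_p)
    (form : {symmetric finvect_type Vn})
    (K0 : {set Fq})
    (P G : Fq -> finvect_type Vn -> Fq) (eps : Fq -> Fq -> int) :
  prime p -> odd p ->
  #|Fq| = (p ^ k)%N -> (s %| k)%N ->
  \dim {:Vn} = n -> ~~ odd n -> (s <= n./2)%N ->
  nondegenerate form ->
  GFsubspace p s K0 ->
  (forall z x, P z x \in GF p Fq s) ->
  (forall z x, G z x \in GF p Fq s) ->
  (forall z c, c \in GFstar p Fq s -> P (c * z) =1 P z) ->
  (forall z, [/\ vectorial_bent R form s (P z),
                 sign_pattern R form s (P z) (eps z) &
                 inversion_type R form s (P z) (G z)]) ->
  {in ~: K0 &, forall z1 z2, {in GFstar p Fq s, eps z1 =1 eps z2}} ->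
  {in K0 :\ 0 &, forall z1 z2, {in GFstar p Fq s, eps z1 =1 eps z2}} ->
  P 0 0 = 0 -> G 0 0 = 0 ->
  let H := Hfun (p := p) k s P in
  let Om := OmegaH k K0 s P in
  let H' s' gamma := Hfun' (p := p) k s s' gamma P in
  let P0' s' gamma := P0' s s' gamma P in
  let Om' s' gamma := OmegaH' k K0 s s' gamma P in
  let delta : nat :=
    if (n == 2 * s)%N && [forall t in GFstar p Fq s, eps 0 t == -1]
    then 0%N else 1%N in
  forall s', (s' %| s)%N ->
  let r' := (p ^ s')%N in
  let delta' : nat := if s' == s then delta else 1%N in
  [/\ 
      forall gamma, gamma \in GFstar p Fq s ->
        fusion (Om' s' gamma) Om /\
        {in GF p Fq s', forall j,
          [/\ cellc K0 (H' s' gamma) j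
                = \bigcup_(i in GF p Fq s | Tr p s s' (gamma * i) == j)
                    cellc K0 H i,
              celld K0 (H' s' gamma) j
                = \bigcup_(i in GF p Fq s | Tr p s s' (gamma * i) == j)
                    celld K0 H i &
              celle (P0' s' gamma) j
                = \bigcup_(i in GF p Fq s | Tr p s s' (gamma * i) == j)
                    celle (P 0) i :> {set finvect_type Vn * Fq * Fq}]},
      forall gamma, gamma \in GFstar p Fq s ->
        [/\ Fourier_reflexive R (formV k form) (Om' s' gamma),
            association_scheme
              (if (K0 == [set 0]) || (K0 == [set: Fq])
               then (2 * r' + delta')%N else (3 * r' + 1 + delta')%N)
              (relations (Om' s' gamma)) &
            fusion_scheme (relations (Om' s' gamma)) (relations Om)],
      forall gamma1 gamma2,
        gamma1 \in GFstar p Fq s -> gamma2 \in GFstar p Fq s ->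
        gamma1 / gamma2 \notin GFstar p Fq s' ->
        Om' s' gamma1 <> Om' s' gamma2 &
      ((p ^ s - 1) %/ (r' - 1)
        <= #|[set relations (Om' s' gamma) | gamma in GFstar p Fq s]|)%N].
Proof.
move=> p_pr p_odd cardF sk <- n_even s_le form_nd K0sub P_GF G_GF P_scale PG epsK1 epsK0.
move=> P00 G00 H Om H' P0' Om' delta s' s's r' delta'.
have P_sign z : sign_pattern R form s (P z) (eps z) by case: (PG z).
have P_inv z : inversion_type R form s (P z) (G z) by case: (PG z).
have deltaE : scheme_delta s Vn eps s' = delta'.
  by rewrite /scheme_delta /delta' /delta; case: (s' == s).
split.
- move=> gamma gG; split; first exact: fusion_OmegaH.
  by move=> j _; exact: cells_fusion.
- move=> gamma gG; split.
  + exact: (Fourier_reflexive_OmegaH' (eps := eps) (G := G)).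
  + rewrite -deltaE; exact: (scheme_OmegaH' (R := R) (form := form) (G := G)).
  + exact: (fusion_scheme_OmegaH (R := R) (form := form) (eps := eps) (G := G)).
- move=> g1 g2 g1G g2G /negP g12 E; apply: g12; exact: OmegaH'_inj E.
- exact: card_fusions.
Qed.
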